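(* Let $G_0$ and $G$ be the groups defined in the context. The group $G_0$ satisfies: (1) the commutator subgroup $G_0'$ is simple; (2) every proper quotient of $G_0$ is abelian; (3) every finite index subgroup of $G_0$ is normal in $G_0$. The group $G$ satisfies: (1) $G''\neq G'$; (2) $G''$ is simple and $G''=G_0'$; (3) every proper quotient of $G$ is metabelian.
   Context: $G_0$ is the group of homeomorphisms of $\mathbb{R}$ generated by the following maps. - $a(t)=t+1$. - $b$, where $b(t)=t$ for $t\le 0$, $b(t)=t/(1-t)$ for $0\le t\le 1/2$, $b(t)=(3t-1)/t$ for $1/2\le t\le 1$, and $b(t)=t+1$ for $t\ge 1$. - $c$, where $c(t)=2t/(t+1)$ for $0\le t\le 1$ and $c(t)=t$ otherwise. Let $2^{\mathbb{N}}$ be the set of infinite binary sequences and $2^{<\mathbb{N}}$ the set of finite ones. Define maps of $2^{\mathbb{N}}$ as follows. - $x$ is given by $x(\mathtt{00}\xi)=\mathtt{0}\xi$, $x(\mathtt{01}\xi)=\mathtt{10}\xi$, $x(\mathtt{1}\xi)=\mathtt{11}\xi$. - $y$ and $y^{-1}$ are defined recursively by $y(\mathtt{00}\xi)=\mathtt{0}y(\xi)$, $y(\mathtt{01}\xi)=\mathtt{10}y^{-1}(\xi)$, $y(\mathtt{1}\xi)=\mathtt{11}y(\xi)$, and $y^{-1}(\mathtt{0}\xi)=\mathtt{00}y^{-1}(\xi)$, $y^{-1}(\mathtt{10}\xi)=\mathtt{01}y(\xi)$, $y^{-1}(\mathtt{11}\xi)=\mathtt{1}y^{-1}(\xi)$.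 - For $\mathtt{s}\in 2^{<\mathbb{N}}$, $x_{\mathtt{s}}(\mathtt{s}\xi)=\mathtt{s}x(\xi)$, and $x_{\mathtt{s}}$ is the identity on sequences not beginning with $\mathtt{s}$. The map $y_{\mathtt{s}}$ is defined similarly. Define $\varphi:2^{\mathbb{N}}\to[0,\infty]$ by $\varphi(\mathtt{0}\xi)=1/(1+1/\varphi(\xi))$ and $\varphi(\mathtt{1}\xi)=1+\varphi(\xi)$. Define $\Phi:2^{\mathbb{N}}\to\mathbb{R}$ by $\Phi(\mathtt{0}\xi)=-\varphi(\tilde\xi)$ and $\Phi(\mathtt{1}\xi)=\varphi(\xi)$, where $\tilde\xi$ swaps $\mathtt0$ and $\mathtt1$. Then $a\circ\Phi=\Phi\circ x$, $b\circ\Phi=\Phi\circ x_{\mathtt1}$ and $c\circ\Phi=\Phi\circ y_{\mathtt{10}}$. Via $\Phi$, every $x_{\mathtt s}$ and $y_{\mathtt s}$ induces a piecewise projective homeomorphism of $\mathbb{R}$. $G$ is the group (of homeomorphisms of $\mathbb{R}$) generated by all $x_{\mathtt s},y_{\mathtt s}$ with $\mathtt{s}\in 2^{<\mathbb{N}}$. $G_0\le G$ is the subgroup generated by all $x_{\mathtt s}$ together with those $y_{\mathtt s}$ for which $\mathtt{s}$ is non-constant, i.e. not of the form $\mathtt0^n$ or $\mathtt1^n$. This $G_0$ coincides with the group generated by $a,b,c$. A proper quotient of a group $\Gamma$ is a quotient $\Gamma/N$ with $N\neq1$ normal. Primes denote derived subgroups. *)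

(* Defs.v *)
From mathcomp Require Import all_boot.
Set Implicit Arguments. Unset Strict Implicit. Unset Printing Implicit Defensive.

Definition cantor := nat -> bool.

Definition lapp (s : seq bool) (xi : cantor) : cantor :=
  fun n => if n < size s then nth false s n else xi (n - size s).
Definition sdrop (k : nat) (xi : cantor) : cantor := fun n => xi (n + k).
Definition cprefix (xi : cantor) (k : nat) : seq bool := map xi (iota 0 k).

Definition xmap (xi : cantor) : cantor :=
  match xi 0, xi 1 with
  | false, false => lapp [:: false] (sdrop 2 xi)
  | false, true  => lapp [:: true; false] (sdrop 2 xi)
  | true, _      => lapp [:: true; true] (sdrop 1 xi)
  end.

(** The recursive definition of y (state [true]) and y^{-1} (state [false]),
    run as a transducer on a finite input word; it stops when the remaining
    input is too short to complete a step. *)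
Fixpoint yrun (st : bool) (l : seq bool) {struct l} : seq bool :=
  if st then
    match l with
    | false :: false :: r => false :: yrun true r
    | false :: true :: r  => true :: false :: yrun false r
    | true :: r           => true :: true :: yrun true r
    | _ => [::]
    end
  else
    match l with
    | false :: r          => false :: false :: yrun false r
    | true :: false :: r  => false :: true :: yrun true r
    | true :: true :: r   => true :: yrun false r
    | _ => [::]
    end.

(** Each step consumes at most 2 bits and produces at least 1 bit, so the
    first 2n+2 input bits determine the first n+1 output bits. *)
Definition ystate (st : bool) (xi : cantor) : cantor :=
  fun n => nth false (yrun st (cprefix xi (2 * n + 2))) n.
Definition ymap : cantor -> cantor := ystate true.

Definition xs (s : seq bool) (xi : cantor) : cantor :=
  if cprefix xi (size s) == s then lapp s (xmap (sdrop (size s) xi)) else xi.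
Definition ys (s : seq bool) (xi : cantor) : cantor :=
  if cprefix xi (size s) == s then lapp s (ymap (sdrop (size s) xi)) else xi.

Definition perm := cantor -> cantor.
Definition pid : perm := fun t => t.
Definition pcomp (f g : perm) : perm := fun t => f (g t).
Definition inv_of (g f : perm) : Prop := pcomp g f = pid /\ pcomp f g = pid.

Inductive gen_by (S : perm -> Prop) : perm -> Prop :=
| gen_id : gen_by S pid
| gen_in f : S f -> gen_by S f
| gen_inv f g : gen_by S f -> inv_of g f -> gen_by S g
| gen_comp f g : gen_by S f -> gen_by S g -> gen_by S (pcomp f g).

Definition commutator (a' b' a b : perm) : perm := pcomp a' (pcomp b' (pcomp a b)).

Definition derived (H : perm -> Prop) : perm -> Prop :=
  gen_by (fun f => exists a b a' b', [/\ H a, H b, inv_of a' a, inv_of b' b &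
                                       f = commutator a' b' a b]).

Definition same_set (A B : perm -> Prop) : Prop := forall f, A f <-> B f.

Definition is_subgroup (H K : perm -> Prop) : Prop :=
  [/\ forall f, H f -> K f, H pid,
      forall f g, H f -> H g -> H (pcomp f g) &
      forall f g, H f -> inv_of g f -> H g].

Definition normal_in (N K : perm -> Prop) : Prop :=
  is_subgroup N K /\
  forall g g' n, K g -> inv_of g' g -> N n -> N (pcomp g (pcomp n g')).

Definition trivial (N : perm -> Prop) : Prop := forall f, N f -> f = pid.

Definition simple (K : perm -> Prop) : Prop :=
  ~ trivial K /\
  forall N, normal_in N K -> trivial N \/ (forall f, K f -> N f).

Definition quot_abelian (K N : perm -> Prop) : Prop :=
  forall a b a' b', K a -> K b -> inv_of a' a -> inv_of b' b ->
    N (commutator a' b' a b).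

(** K/N is metabelian: (K/N)' = K'N/N is abelian, i.e. every commutator of
    elements of K' is trivial mod N. *)
Definition quot_metabelian (K N : perm -> Prop) : Prop :=
  quot_abelian (derived K) N.

Definition finite_index (H K : perm -> Prop) : Prop :=
  exists reps : seq perm, (forall i, i < size reps -> K (nth pid reps i)) /\
    forall g, K g -> exists2 i, i < size reps &
      exists h, H h /\ g = pcomp (nth pid reps i) h.

Definition constant_word (s : seq bool) : bool := ~~ ((true \in s) && (false \in s)).

Definition G : perm -> Prop :=
  gen_by (fun f => exists s, f = xs s \/ f = ys s).
Definition G0 : perm -> Prop :=
  gen_by (fun f => exists s, f = xs s \/ (~~ constant_word s /\ f = ys s)).

(* Main.v *)
(** Everything happens on the Cantor set.  Write K = G0' and call the cones at
    0^n and 1^n the n-th ends.  Near the ends G0 acts by shifts, so each element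
    of K fixes some n-th ends pointwise; conversely every element of G agrees
    with an element of K off the n-th ends, and some element of K moves the
    complement of the ends into any cone with non-constant address.  Higman's
    double commutator trick then shows that a nontrivial N normalized by a
    group M between K and G contains [g, h] for all g, h in M fixing some ends.
    For M = G0 the relations x_s^2 = x_s1 x_s x_s0 and the conjugacy of the
    generators with non-constant address make G0 / N abelian; N = K' gives
    K = K', and M = K gives simplicity.  The normal core of a finite index
    subgroup contains a power of x, hence K.

    For G, conjugation by W = y_1 y_0^-1 maps G0 into itself, so the union T of
    the groups W^-n G0 W^n is normal in G; G / T is abelian and T' = K, whence
    G'' = K.  The commutator y_1 x y_1^-1 x^-1 is a nontrivial shift near 1^oo,
    so G' <> K. *)
Require Import Defs.
From mathcomp Require Import all_boot zify.
From Stdlib Require Import Lia FunctionalExtensionality PropExtensionality Classical.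

(* [Import] again: ssrfun also has a [pcomp]. *)
Import Defs.

Set Implicit Arguments. Unset Strict Implicit. Unset Printing Implicit Defensive.

(** * Words, cones and copies of a map inside a cone *)

Definition ccons (b : bool) (xi : cantor) : cantor := lapp [:: b] xi.
Arguments ccons : simpl never.
Notation "b |> xi" := (ccons b xi) (at level 60, right associativity).

Notation "f ** g" := (pcomp f g) (at level 40, left associativity).

Lemma cconsE b xi n : (b |> xi) n = if n is m.+1 then xi m else b.
Proof. by case: n => [|n] //; rewrite /ccons /lapp /= subn1. Qed.

Lemma lapp_nil xi : lapp [::] xi = xi.
Proof. by apply: functional_extensionality => n; rewrite /lapp /= subn0. Qed.

Lemma lapp_cons b s xi : lapp (b :: s) xi = b |> lapp s xi.
Proof.
by apply: functional_extensionality => -[|n]; rewrite cconsE // /lapp /= ltnS subSS.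
Qed.

Lemma lapp_cat s t xi : lapp (s ++ t) xi = lapp s (lapp t xi).
Proof. by elim: s => [|b s IH]; rewrite ?lapp_nil //= !lapp_cons IH. Qed.

Lemma sdrop1_ccons b xi : sdrop 1 (b |> xi) = xi.
Proof. by apply: functional_extensionality => n; rewrite /sdrop addn1 cconsE. Qed.

Lemma sdropS n xi : sdrop n.+1 xi = sdrop n (sdrop 1 xi).
Proof. by apply: functional_extensionality => i; rewrite /sdrop addn1 addnS. Qed.

Lemma sdrop0 xi : sdrop 0 xi = xi.
Proof. by apply: functional_extensionality => i; rewrite /sdrop addn0. Qed.

Lemma ccons_sdrop xi : xi 0 |> sdrop 1 xi = xi.
Proof.
by apply: functional_extensionality => -[|n]; rewrite cconsE // /sdrop addn1.
Qed.

Lemma cconsP xi : exists b eta, xi = b |> eta.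
Proof. by exists (xi 0), (sdrop 1 xi); rewrite ccons_sdrop. Qed.

Lemma ccons_inj a b xi eta : a |> xi = b |> eta -> a = b /\ xi = eta.
Proof.
move=> E; split; first by have := congr1 (@^~ 0) E; rewrite !cconsE.
by rewrite -(sdrop1_ccons a xi) E sdrop1_ccons.
Qed.

Lemma cprefixS n b xi : cprefix (b |> xi) n.+1 = b :: cprefix xi n.
Proof.
rewrite /cprefix /= cconsE -[1]addn0 iotaDl -map_comp; congr cons.
by apply: eq_map => i; rewrite /= cconsE.
Qed.

Lemma cprefix_cat m n xi :
  cprefix xi (m + n) = cprefix xi m ++ cprefix (sdrop m xi) n.
Proof.
rewrite /cprefix iotaD map_cat add0n -[in iota m n](addn0 m) iotaDl -map_comp.
by congr cat; apply: eq_map => i; rewrite /= /sdrop addnC.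
Qed.

(** [xs] and [ys] are the instances of this operation at [xmap] and [ymap]. *)
Definition within (s : seq bool) (f : perm) : perm := fun xi =>
  if cprefix xi (size s) == s then lapp s (f (sdrop (size s) xi)) else xi.

Arguments within : simpl never.

Lemma within_nil f : within [::] f = f.
Proof.
by apply: functional_extensionality => xi; rewrite /within /= lapp_nil sdrop0.
Qed.

Lemma within_cons b s f c xi :
  within (b :: s) f (c |> xi) = c |> (if b == c then within s f xi else xi).
Proof.
rewrite /within /= sdropS sdrop1_ccons cprefixS eqseq_cons eq_sym.
by case: eqVneq => [->|] //=; case: ifP => // _; rewrite lapp_cons.
Qed.

Lemma within_lapp s f xi : within s f (lapp s xi) = lapp s (f xi).
Proof.
elim: s => [|b s IH]; first by rewrite within_nil !lapp_nil.
by rewrite !lapp_cons within_cons eqxx IH.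
Qed.

Lemma within_cat s t f : within (s ++ t) f = within s (within t f).
Proof.
apply: functional_extensionality; elim: s => [|b s IH] xi; first by rewrite within_nil.
by have [c [eta ->]] := cconsP xi; rewrite !within_cons IH.
Qed.

Lemma within_comp s f g : within s (pcomp f g) = pcomp (within s f) (within s g).
Proof.
apply: functional_extensionality; rewrite /pcomp.
elim: s => [|b s IH] xi; first by rewrite !within_nil.
have [c [eta ->]] := cconsP xi; rewrite !within_cons.
by case: eqP => // _; rewrite IH.
Qed.

Lemma within_id s : within s pid = pid.
Proof.
apply: functional_extensionality.
elim: s => [|b s IH] xi; first by rewrite within_nil.
by have [c [eta ->]] := cconsP xi; rewrite within_cons IH /pid if_same.
Qed.

Definition cone (s : seq bool) (xi : cantor) : Prop := exists eta, xi = lapp s eta.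

Lemma within_out s f xi : ~ cone s xi -> within s f xi = xi.
Proof.
elim: s xi => [|b s IH] xi nC; first by case: nC; exists xi; rewrite lapp_nil.
have [c [eta E]] := cconsP xi; rewrite E within_cons; case: eqP => // bc.
rewrite IH // => -[zeta Z]; apply: nC; exists zeta.
by rewrite E lapp_cons bc Z.
Qed.

Lemma lapp_inj s xi eta : lapp s xi = lapp s eta -> xi = eta.
Proof.
elim: s => [|b s IH]; rewrite ?lapp_nil // !lapp_cons.
by move=> /ccons_inj [_ /IH].
Qed.

(** * Invertible maps and groups of maps *)

Lemma inv_ofP (g f : perm) : inv_of g f <-> cancel f g /\ cancel g f.
Proof.
split=> [[gf fg]|[fK gK]].
  by split=> t; [apply: (congr1 (@^~ t) gf) | apply: (congr1 (@^~ t) fg)].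
by split; apply: functional_extensionality => t; rewrite /pcomp ?fK ?gK.
Qed.

Lemma inv_ofC g f : inv_of g f -> inv_of f g.
Proof. by case. Qed.

Lemma inv_of_id : inv_of pid pid.
Proof. by []. Qed.

Lemma inv_of_comp f' f g' g :
  inv_of f' f -> inv_of g' g -> inv_of (pcomp g' f') (pcomp f g).
Proof.
move=> /inv_ofP[fK fK'] /inv_ofP[gK gK']; apply/inv_ofP.
by split=> t; rewrite /pcomp ?fK ?gK ?gK' ?fK'.
Qed.

Lemma inv_of_uniq g h f : inv_of g f -> inv_of h f -> g = h.
Proof.
move=> /inv_ofP[_ gK] /inv_ofP[fK _].
by apply: functional_extensionality => t; rewrite -{2}(gK t) fK.
Qed.

Lemma inv_of_within s g f : inv_of g f -> inv_of (within s g) (within s f).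
Proof. by move=> [gf fg]; split; rewrite -within_comp ?gf ?fg within_id. Qed.

(** * The maps x and y *)

Definition xinv (xi : cantor) : cantor :=
  match xi 0, xi 1 with
  | false, _    => lapp [:: false; false] (sdrop 1 xi)
  | true, false => lapp [:: false; true] (sdrop 2 xi)
  | true, true  => lapp [:: true] (sdrop 2 xi)
  end.

Lemma xmap00 xi : xmap (false |> false |> xi) = false |> xi.
Proof. by rewrite /xmap !cconsE /= lapp_cons lapp_nil sdropS !sdrop1_ccons. Qed.
Lemma xmap01 xi : xmap (false |> true |> xi) = true |> false |> xi.
Proof. by rewrite /xmap !cconsE /= !lapp_cons lapp_nil sdropS !sdrop1_ccons. Qed.
Lemma xmap1 xi : xmap (true |> xi) = true |> true |> xi.
Proof. by rewrite /xmap !cconsE /= !lapp_cons lapp_nil !sdrop1_ccons. Qed.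
Lemma xinv0 xi : xinv (false |> xi) = false |> false |> xi.
Proof. by rewrite /xinv !cconsE /= !lapp_cons lapp_nil !sdrop1_ccons. Qed.
Lemma xinv10 xi : xinv (true |> false |> xi) = false |> true |> xi.
Proof. by rewrite /xinv !cconsE /= !lapp_cons lapp_nil sdropS !sdrop1_ccons. Qed.
Lemma xinv11 xi : xinv (true |> true |> xi) = true |> xi.
Proof. by rewrite /xinv !cconsE /= !lapp_cons lapp_nil sdropS !sdrop1_ccons. Qed.

Definition xE := (xmap00, xmap01, xmap1, xinv0, xinv10, xinv11).

Lemma inv_of_x : inv_of xinv xmap.
Proof.
apply/inv_ofP; split=> xi; have [[] [eta ->]] := cconsP xi; rewrite ?xE //;
  by have [[] [zeta ->]] := cconsP eta; rewrite !xE.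
Qed.

(** A longer input only extends the output. The induction is on length because one step may consume
    two letters. *)
Lemma yrun_cat st l r : exists w, yrun st (l ++ r) = yrun st l ++ w.
Proof.
have [n] := ubnP (size l); elim: n => // n IH in st l *; rewrite ltnS.
case: st; case: l => [|a l] sl; try by eexists.
- case: a sl => sl; first by have [w /= ->] := IH true l sl; exists w.
  case: l sl => [|[] l] sl; first by eexists.
    by have [w /= ->] := IH false l (ltnW sl); exists w.
  by have [w /= ->] := IH true l (ltnW sl); exists w.
- case: a sl => sl; last by have [w /= ->] := IH false l sl; exists w.
  case: l sl => [|[] l] sl; first by eexists.
    by have [w /= ->] := IH false l (ltnW sl); exists w.
  by have [w /= ->] := IH true l (ltnW sl); exists w.
Qed.

Lemma size_yrun st l n : n.*2 <= size l -> n <= size (yrun st l).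
Proof.
elim: n st l => // n IH [] [|[] l] /=; rewrite ?doubleS ?ltnS => sl //.
- by apply: leqW; apply: IH; apply: ltnW.
- case: l sl => [|[] l] //=; rewrite ?ltnS => sl; last exact: IH.
  by apply: leqW; apply: IH.
- case: l sl => [|[] l] //=; rewrite ?ltnS => sl; first exact: IH.
  by apply: leqW; apply: IH.
- by apply: leqW; apply: IH; apply: ltnW.
Qed.

(** Frees [ystate] from its exact prefix length, since after one step of the transducer the
    remaining input has a different length. *)
Lemma ystate_nth st xi n m :
  2 * n + 2 <= m -> ystate st xi n = nth false (yrun st (cprefix xi m)) n.
Proof.
move=> nm; rewrite /ystate -[in RHS](subnKC nm) [in RHS]cprefix_cat.
have [w ->] := yrun_cat st (cprefix xi (2 * n + 2))
                 (cprefix (sdrop (2 * n + 2) xi) (m - (2 * n + 2))).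
by rewrite nth_cat size_yrun // size_map size_iota; lia.
Qed.

Lemma cprefix_lapp s xi n : cprefix (lapp s xi) (size s + n) = s ++ cprefix xi n.
Proof. by elim: s => [|b s IH]; rewrite ?lapp_nil // lapp_cons cprefixS IH. Qed.

(** Lifts one transducer step from finite words to sequences; the six recursive equations of [ymap]
    and [yinv] are instances. *)
Lemma ystate_step w out st st' xi :
    (forall l, yrun st (w ++ l) = out ++ yrun st' l) ->
  ystate st (lapp w xi) = lapp out (ystate st' xi).
Proof.
move=> E; apply: functional_extensionality => n.
rewrite (@ystate_nth _ _ n (size w + (2 * n + 2))) ?leq_addl //.
rewrite cprefix_lapp E nth_cat /lapp; case: ifP => // _.
by rewrite (@ystate_nth _ _ _ (2 * n + 2)) //; lia.
Qed.

Definition yinv : perm := ystate false.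

Lemma ymap00 xi : ymap (false |> false |> xi) = false |> ymap xi.
Proof.
have := @ystate_step [:: false; false] [:: false] true true xi.
by rewrite !lapp_cons !lapp_nil; exact.
Qed.
Lemma ymap01 xi : ymap (false |> true |> xi) = true |> false |> yinv xi.
Proof.
have := @ystate_step [:: false; true] [:: true; false] true false xi.
by rewrite !lapp_cons !lapp_nil; exact.
Qed.
Lemma ymap1 xi : ymap (true |> xi) = true |> true |> ymap xi.
Proof.
have := @ystate_step [:: true] [:: true; true] true true xi.
by rewrite !lapp_cons !lapp_nil; exact.
Qed.
Lemma yinv0 xi : yinv (false |> xi) = false |> false |> yinv xi.
Proof.
have := @ystate_step [:: false] [:: false; false] false false xi.
by rewrite !lapp_cons !lapp_nil; exact.
Qed.
Lemma yinv10 xi : yinv (true |> false |> xi) = false |> true |> ymap xi.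
Proof.
have := @ystate_step [:: true; false] [:: false; true] false true xi.
by rewrite !lapp_cons !lapp_nil; exact.
Qed.
Lemma yinv11 xi : yinv (true |> true |> xi) = true |> yinv xi.
Proof.
have := @ystate_step [:: true; true] [:: true] false false xi.
by rewrite !lapp_cons !lapp_nil; exact.
Qed.

Definition yE := (ymap00, ymap01, ymap1, yinv0, yinv10, yinv11).

(** * Uniform continuity *)

Definition agree n (xi eta : cantor) : Prop := forall i, i < n -> xi i = eta i.

Lemma agree_ccons n b c xi eta :
  agree n.+1 (b |> xi) (c |> eta) <-> b = c /\ agree n xi eta.
Proof.
split=> [A|[-> A] [|i] ?]; rewrite ?cconsE //; last exact: A.
split=> [|i ?]; first by have := A 0 isT; rewrite !cconsE.
by have := A i.+1; rewrite !cconsE; apply.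
Qed.

Lemma agreeW m n xi eta : m <= n -> agree n xi eta -> agree m xi eta.
Proof. by move=> mn A i im; apply: A; apply: leq_trans mn. Qed.

Lemma agree_eq xi eta : (forall n, agree n xi eta) -> xi = eta.
Proof. by move=> A; apply: functional_extensionality => n; apply: (A n.+1). Qed.

Lemma agree_cons n b xi eta : agree n xi eta -> agree n (b |> xi) (b |> eta).
Proof. by case: n => // n A; apply/agree_ccons; split=> //; apply: agreeW A. Qed.

(** Both composites are treated at once because the recursions of y and y^{-1} call each other. Each
    case exposes a correct letter before the induction hypothesis is used. *)
Lemma agree_yK n xi : agree n (yinv (ymap xi)) xi /\ agree n (ymap (yinv xi)) xi.
Proof.
elim: n xi => [|n IH] xi; first by split.
have [b [eta ->]] := cconsP xi; have [c [zeta Z]] := cconsP eta.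
have [[IH1 IH2] [IH3 IH4]] := (IH eta, IH zeta).
split; case: b.
- by rewrite ymap1 yinv11; apply/agree_ccons.
- by rewrite Z; case: c Z => _; rewrite ?ymap01 ?ymap00 ?yinv10 ?yinv0;
    apply/agree_ccons; split=> //; apply: agree_cons.
- by rewrite Z; case: c Z => _; rewrite ?yinv10 ?yinv11 ?ymap01 ?ymap1;
    apply/agree_ccons; split=> //; apply: agree_cons.
- by rewrite yinv0 ymap00; apply/agree_ccons.
Qed.

Lemma inv_of_y : inv_of yinv ymap.
Proof.
by apply/inv_ofP; split=> xi; apply: agree_eq => n; have [] := agree_yK n xi.
Qed.

Definition ucont (f : perm) : Prop :=
  forall n, exists m, forall xi eta, agree m xi eta -> agree n (f xi) (f eta).

Lemma ucont_id : ucont pid.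
Proof. by move=> n; exists n. Qed.

Lemma ucont_comp f g : ucont f -> ucont g -> ucont (f ** g).
Proof.
by move=> fc gc n; have [m fm] := fc n; have [k gk] := gc m; exists k => *; apply/fm/gk.
Qed.

Lemma ucont_within s f : ucont f -> ucont (within s f).
Proof.
move=> fc; elim: s => [|b s IH]; first by rewrite within_nil.
case=> [|n]; first by exists 0.
have [m sm] := IH n; exists (maxn n m).+1 => xi eta.
have [c [xi' ->]] := cconsP xi; have [d [eta' ->]] := cconsP eta.
move=> /agree_ccons[-> A]; rewrite !within_cons; apply/agree_ccons; split=> //.
case: eqP => _; last by apply: agreeW A; rewrite leq_maxl.
by apply: sm; apply: agreeW A; rewrite leq_maxr.
Qed.

Lemma ucont_ystate st : ucont (ystate st).
Proof.
move=> n; exists (2 * n + 2) => xi eta A i ni; rewrite /ystate /cprefix; congr (nth _ (yrun _ _) _).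
by apply/eq_in_map => j; rewrite mem_iota => /andP[_ jn]; apply: A; lia.
Qed.

Lemma agree_lapp n s k xi eta :
  agree (n + k) xi eta -> agree n (lapp s (sdrop k xi)) (lapp s (sdrop k eta)).
Proof. by move=> A i ni; rewrite /lapp /sdrop; case: ifP => // _; apply: A; lia. Qed.

Lemma ucont_xmap : ucont xmap.
Proof.
move=> n; exists (n + 2) => xi eta A; rewrite /xmap !A ?addn2 //.
by case: (eta 0); [|case: (eta 1)]; apply: agree_lapp; apply: agreeW A; rewrite leq_add2l.
Qed.

Lemma ucont_xinv : ucont xinv.
Proof.
move=> n; exists (n + 2) => xi eta A; rewrite /xinv !A ?addn2 //.
by case: (eta 0); [case: (eta 1)|]; apply: agree_lapp; apply: agreeW A; rewrite leq_add2l.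
Qed.

(** Decides equations of words in maps that hold by free cancellation alone. *)
Ltac group_eq :=
  repeat match goal with H : inv_of _ _ |- _ => move/inv_ofP: H => [? ?] end;
  let t := fresh "t" in
  apply: functional_extensionality => t; rewrite /commutator /pcomp /pid;
  repeat match goal with
    H : cancel ?f ?g |- context [?g (?f ?z)] => rewrite (H z) end;
  try reflexivity.

(** * Groups of maps, commutators and derived subgroups *)

Record perm_group (H : perm -> Prop) : Prop := PermGroup {
  pg1 : H pid;
  pgM : forall f g, H f -> H g -> H (f ** g);
  pgV : forall f g, H f -> inv_of g f -> H g;
  pgI : forall f, H f -> exists g, inv_of g f }.

Ltac group_mem gH :=
  repeat match goal with |- _ (_ ** _) => apply: (pgM gH) end; try assumption.

Lemma gen_group (S : perm -> Prop) :
  (forall f, S f -> exists g, inv_of g f) -> perm_group (gen_by S).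
Proof.
move=> SI; split; [exact: gen_id | exact: gen_comp | exact: gen_inv |].
move=> f; elim=> {f} [|f /SI //|f g _ _ /inv_ofC fg|f g _ [f' ff] _ [g' gg]].
- by exists pid.
- by exists f.
- by exists (g' ** f'); apply: inv_of_comp.
Qed.

Lemma gen_by_min (S H : perm -> Prop) :
  perm_group H -> (forall f, S f -> H f) -> forall f, gen_by S f -> H f.
Proof.
move=> gH SH f; elim=> {f} [|f /SH //|f g _ Hf gf|f g _ Hf _ Hg].
- exact: pg1.
- exact: pgV gf.
- exact: pgM.
Qed.

Lemma subgroup_group (H K : perm -> Prop) :
  perm_group K -> is_subgroup H K -> perm_group H.
Proof. by move=> gK [HK H1 HM HV]; split=> // f /HK /(pgI gK). Qed.

Definition normalizes (M N : perm -> Prop) : Prop :=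
  forall g g' n, M g -> inv_of g' g -> N n -> N (g ** (n ** g')).

Lemma group_normalizes M : perm_group M -> normalizes M M.
Proof. by move=> gM g g' n Mg gg Mn; group_mem gM; apply: (pgV gM) gg. Qed.

Lemma commutator_inv (a b a' b' : perm) :
  inv_of a' a -> inv_of b' b -> inv_of (commutator b' a' b a) (commutator a' b' a b).
Proof. by move=> ha hb; split; group_eq. Qed.

Lemma derived_group H : perm_group H -> perm_group (derived H).
Proof.
move=> gH; apply: gen_group => f [a [b [a' [b' [_ _ ha hb ->]]]]].
by exists (commutator b' a' b a); apply: commutator_inv.
Qed.

Lemma derived_min H N : perm_group N ->
    (forall a b a' b', H a -> H b -> inv_of a' a -> inv_of b' b ->
      N (commutator a' b' a b)) ->
  forall f, derived H f -> N f.
Proof.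
move=> gN HN; apply: gen_by_min => // f [a [b [a' [b' [Ha Hb ha hb ->]]]]].
exact: HN.
Qed.

Lemma derived_commutator H a b a' b' : H a -> H b -> inv_of a' a -> inv_of b' b ->
  derived H (commutator a' b' a b).
Proof. by move=> *; apply: gen_in; exists a, b, a', b'. Qed.

Lemma commutator_closed H a b a' b' : perm_group H ->
  H a -> H b -> inv_of a' a -> inv_of b' b -> H (commutator a' b' a b).
Proof.
move=> gH Ha Hb ha hb; have Ha' := pgV gH Ha ha; have Hb' := pgV gH Hb hb.
by rewrite /commutator; group_mem gH.
Qed.

Lemma derived_sub H : perm_group H -> forall f, derived H f -> H f.
Proof. by move=> gH; apply: derived_min => // *; apply: commutator_closed. Qed.

Lemma derived_mono (H K : perm -> Prop) :
  (forall f, H f -> K f) -> perm_group K -> forall f, derived H f -> derived K f.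
Proof.
move=> HK gK; apply: derived_min; first exact: derived_group.
by move=> *; apply: derived_commutator; auto.
Qed.

Lemma derived_normalizes M H :
  perm_group H -> normalizes M H -> normalizes M (derived H).
Proof.
move=> gH nMH g g' n Mg gg.
elim=> {n} [|f [a [b [a' [b' [Ha Hb ha hb ->]]]]]|f f' _ IH ff|f h _ IHf _ IHh].
- have -> : g ** (pid ** g') = pid by group_eq.
  exact: gen_id.
- have -> : g ** (commutator a' b' a b ** g') =
      commutator (g ** (a' ** g')) (g ** (b' ** g')) (g ** (a ** g')) (g ** (b ** g')) by group_eq.
  by apply: derived_commutator; [exact: nMH|exact: nMH|split; group_eq|split; group_eq].
- by apply: gen_inv IH _; split; group_eq.
- have -> : g ** (f ** h ** g') = (g ** (f ** g')) ** (g ** (h ** g')) by group_eq.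
  exact: gen_comp.
Qed.

(** * Commuting modulo a normalized subgroup *)

(** This form mentions no inverses; [com_commutator] translates it back to commutators. *)
Definition com (N : perm -> Prop) (a b : perm) : Prop :=
  exists2 n, N n & a ** b = b ** a ** n.

Lemma com_commutator N a b a' b' : inv_of a' a -> inv_of b' b ->
  com N a b <-> N (commutator a' b' a b).
Proof.
move=> ha hb; split=> [[n Nn E]|Nn].
  suff -> : commutator a' b' a b = n by [].
  by rewrite /commutator E; group_eq.
by exists (commutator a' b' a b) => //; group_eq.
Qed.

Lemma com_sym N a b : perm_group N -> com N a b -> com N b a.
Proof.
move=> gN [n Nn E]; have [n' nn] := pgI gN Nn.
by exists n'; [apply: pgV nn | rewrite E; group_eq].
Qed.

Lemma com_id N b : perm_group N -> com N pid b.
Proof. by move=> gN; exists pid; [apply: pg1|]. Qed.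

Lemma com_inv M N a a' b : perm_group N -> normalizes M N -> M a -> inv_of a' a ->
  com N a b -> com N a' b.
Proof.
move=> gN nMN Ma aa [n Nn E]; have [n' nn] := pgI gN Nn.
exists (a ** (n' ** a')); first by apply: nMN => //; apply: pgV nn.
have -> : b ** a' ** (a ** (n' ** a')) = a' ** (b ** a ** n) ** n' ** a'.
  by rewrite -E; group_eq.
by group_eq.
Qed.

Lemma com_comp M N a b c : perm_group M -> perm_group N -> normalizes M N ->
  M b -> com N a c -> com N b c -> com N (a ** b) c.
Proof.
move=> gM gN nMN Mb [m Nm Em] [n Nn En]; have [b' bb] := pgI gM Mb.
exists (b' ** (m ** b) ** n).
  by apply: (pgM gN) => //; apply: nMN => //; [apply: (pgV gM) bb|apply: inv_ofC].
have -> : a ** b ** c = a ** (b ** c) by [].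
have -> : c ** (a ** b) ** (b' ** (m ** b) ** n) = c ** a ** m ** b ** n by group_eq.
by rewrite En -Em.
Qed.

(** Stated for [M] described by an induction principle, as [G] and [G0] are
    used with generating sets other than the defining ones. *)
Lemma com_generators (M N S : perm -> Prop) :
    perm_group M -> perm_group N -> normalizes M N ->
    (forall f, S f -> M f) ->
    (forall H : perm -> Prop, perm_group H -> (forall f, S f -> H f) -> forall f, M f -> H f) ->
    (forall a b, S a -> S b -> com N a b) ->
  forall a b a' b', M a -> M b -> inv_of a' a -> inv_of b' b ->
    N (commutator a' b' a b).
Proof.
move=> gM gN nMN SM indM SC.
(* The elements commuting with [c] modulo [N] form a group. This is used twice: first for a
   generator [c], then for an arbitrary one. *)
have cent c : M c -> (forall s, S s -> com N s c) -> forall f, M f -> com N f c.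
  move=> Mc Sc f Mf.
  suff [] : M f /\ com N f c by [].
  apply: (indM (fun f => M f /\ com N f c)) Mf; last by move=> s Ss; split; auto.
  split.
  - by split; [apply: pg1 | apply: com_id].
  - by move=> g h [Mg ?] [Mh ?]; split; [apply: pgM | apply: (com_comp gM gN nMN)].
  - by move=> g h [Mg ?] hg; split; [apply: pgV hg | apply: (com_inv gN nMN Mg hg)].
  - by move=> g [/(pgI gM)].
have centS s : S s -> forall f, M f -> com N f s.
  by move=> Ss; apply: cent; [apply: SM | move=> s' Ss'; apply: SC].
move=> a b a' b' Ma Mb ha hb; apply/com_commutator => //.
by apply: (cent b) => // s Ss; apply: com_sym => //; apply: centS.
Qed.

(** * The groups G0 and G *)

Lemma inv_of_xs s : inv_of (within s xinv) (within s xmap).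
Proof. exact: inv_of_within inv_of_x. Qed.

Lemma inv_of_ys s : inv_of (within s yinv) (within s ymap).
Proof. exact: inv_of_within inv_of_y. Qed.

Lemma G_group : perm_group G.
Proof.
apply: gen_group => f [s [] ->].
- by exists (within s xinv); apply: inv_of_xs.
- by exists (within s yinv); apply: inv_of_ys.
Qed.

Lemma G0_group : perm_group G0.
Proof.
apply: gen_group => f [s [|[_]] ->].
- by exists (within s xinv); apply: inv_of_xs.
- by exists (within s yinv); apply: inv_of_ys.
Qed.

Lemma G0_xs s : G0 (within s xmap).
Proof. by apply: gen_in; exists s; left. Qed.

Lemma G0_ys s : ~~ constant_word s -> G0 (within s ymap).
Proof. by move=> ns; apply: gen_in; exists s; right. Qed.

Lemma G0_G f : G0 f -> G f.
Proof.
apply: gen_by_min => [|{}f [s [|[_]] ->]]; first exact: G_group.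
- by apply: gen_in; exists s; left.
- by apply: gen_in; exists s; right.
Qed.

Lemma G_ys s : G (within s ymap).
Proof. by apply: gen_in; exists s; right. Qed.

(** * Relations and conjugacy of the generators *)

(** The pentagon relation for tree rotations, checked on the first letters. *)
Lemma xx_relation s :
  within s xmap ** within s xmap = within (s ++ [:: true]) xmap ** within s xmap **
      within (s ++ [:: false]) xmap.
Proof.
rewrite !within_cat -!within_comp; congr within.
apply: functional_extensionality => xi.
rewrite /pcomp; have [b [eta ->]] := cconsP xi; have [c [zeta Z]] := cconsP eta.
case: b; first by rewrite within_cons /= !xmap1 within_cons within_nil xmap1.
rewrite Z; case: c Z => _; rewrite within_cons within_nil /= !xE.
  by rewrite within_cons within_nil xE.
by have [[] [theta ->]] := cconsP zeta; rewrite ?xE ?within_cons /= ?within_nil ?xE.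
Qed.

(** The recursive definition of y as a relation: x rearranges the prefixes, then y or y^{-1} acts in
    each of the three cones at s0, s10 and s11. *)
Lemma y_relation s :
  within s ymap = within (s ++ [:: false]) ymap ** within (s ++ [:: true; false]) yinv
                ** within (s ++ [:: true; true]) ymap ** within s xmap.
Proof.
rewrite !within_cat -!within_comp; congr within.
apply: functional_extensionality => xi.
rewrite /pcomp; have [b [eta ->]] := cconsP xi; have [c [zeta Z]] := cconsP eta.
case: b; first by rewrite xmap1 ymap1; do 3!rewrite ?within_cons ?within_nil /=.
by rewrite Z; case: c Z => _; rewrite !xE !yE; do 3!rewrite ?within_cons ?within_nil /=.
Qed.

Lemma conj_within f f' s t u : inv_of f' f ->
  (forall xi, f (lapp s xi) = lapp t xi) -> f ** (within s u ** f') = within t u.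
Proof.
move=> /inv_ofP[fK fK'] st; apply: functional_extensionality => xi; rewrite /pcomp.
have [[eta ->]|nC] := classic (cone t xi).
  by rewrite -{1}st fK !within_lapp st.
rewrite !within_out ?fK' // => -[eta E]; apply: nC; exists eta.
by rewrite -st -E fK'.
Qed.

(** The maps x, x_0, x_1 and their inverses shorten a non-constant address letter by letter down to
    01 or 10. [H] is arbitrary because the lemma serves to prove that three maps generate [G0]. *)
Lemma word_move H s : perm_group H ->
    H xmap -> H (within [:: false] xmap) -> H (within [:: true] xmap) ->
    ~~ constant_word s ->
  exists2 f, H f & forall xi, f (lapp s xi) = lapp [:: true; false] xi.
Proof.
move=> gH Hx Hx0 Hx1.
have Hx' := pgV gH Hx inv_of_x.
have Hx0' := pgV gH Hx0 (inv_of_xs _); have Hx1' := pgV gH Hx1 (inv_of_xs _).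
have [n] := ubnP (size s); elim: n => // n IH in s *; rewrite ltnS => sn ns.
have step m s' : size s' < size s -> ~~ constant_word s' -> H m ->
    (forall xi, m (lapp s xi) = lapp s' xi) ->
    exists2 f, H f & forall xi, f (lapp s xi) = lapp [:: true; false] xi.
  move=> ss ns' Hm E; have [|f Hf fE] := IH s' _ ns'; first exact: leq_trans sn.
  by exists (f ** m); [apply: pgM | move=> xi; rewrite /pcomp E fE].
case: s sn ns step => [|[] [|[] w]] //= _ ns step.
- by apply: (step xinv (true :: w)) => // xi; rewrite !lapp_cons xE.
- case: w ns step => [|[] w] ns step.
  + by exists pid; [apply: pg1|].
  + apply: (step (xinv ** within [:: true] xmap) (true :: false :: w)) => //; [exact: (pgM gH)|].
    by move=> xi; rewrite /pcomp !lapp_cons within_cons within_nil !xE.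
  + apply: (step (within [:: true] xmap) (true :: false :: w)) => //.
    by move=> xi; rewrite !lapp_cons within_cons within_nil !xE.
- case: w ns step => [|[] w] ns step.
  + by exists xmap => // xi; rewrite !lapp_cons !xE.
  + apply: (step (within [:: false] xinv) (false :: true :: w)) => //.
    by move=> xi; rewrite !lapp_cons within_cons within_nil !xE.
  + apply: (step (xmap ** within [:: false] xinv) (false :: true :: w)) => //; [exact: (pgM gH)|].
    by move=> xi; rewrite /pcomp !lapp_cons within_cons within_nil !xE.
- by apply: (step xmap (false :: w)) => // xi; rewrite !lapp_cons xE.
Qed.

Lemma constant_wordE s : constant_word s -> exists b, s = nseq (size s) b.
Proof.
elim: s => [|b s IH] cs; first by exists true.
exists b; rewrite /=; congr cons; apply/all_pred1P/allP => c cs'; apply/eqP.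
by move: cs; rewrite /constant_word !inE; case: b c cs' => [] [] // ->; rewrite ?andbT ?orbT.
Qed.

Lemma lapp_nseqS n b xi : lapp (nseq n.+1 b) xi = lapp (nseq n b) (b |> xi).
Proof. by rewrite -addn1 nseqD lapp_cat lapp_cons lapp_nil. Qed.

Lemma lapp_nseqSr n b xi : lapp (nseq n.+1 b) xi = b |> lapp (nseq n b) xi.
Proof. by rewrite lapp_cons. Qed.

Lemma conj_x1 n u : xmap ** (within (nseq n.+1 true) u ** xinv) = within (nseq n.+2 true) u.
Proof. by apply: conj_within => [|xi]; [apply: inv_of_x | rewrite !lapp_nseqSr xE]. Qed.

Lemma conj_x0 n u : xinv ** (within (nseq n.+1 false) u ** xmap) = within (nseq n.+2 false) u.
Proof. by apply: conj_within => [|xi]; [apply: inv_ofC inv_of_x | rewrite !lapp_nseqSr xE]. Qed.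

(** Under the coding of the real line these are a, b and c. *)
Definition gens0 (f : perm) : Prop :=
  [\/ f = xmap, f = within [:: true] xmap | f = within [:: true; false] ymap].

Definition gens (f : perm) : Prop :=
  [\/ gens0 f, f = within [:: false] ymap | f = within [:: true] ymap].

Lemma gens0_G0 f : gens0 f -> G0 f.
Proof. by case=> ->; [rewrite -[xmap]within_nil; apply: G0_xs | apply: G0_xs | apply: G0_ys]. Qed.

Lemma gens_G f : gens f -> G f.
Proof. by case=> [/gens0_G0/G0_G //|->|->]; apply: G_ys. Qed.

(** The relation at the empty word yields x_0, and conjugation by x the other x_s with constant s.
    The relation at 1 yields x_10, and [word_move] transports x_10 and y_10 to all non-constant
    addresses. *)
Lemma G0_gens0 (H : perm -> Prop) : perm_group H -> (forall f, gens0 f -> H f) ->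
  forall f, G0 f -> H f.
Proof.
move=> gH HS.
have Hx : H xmap by apply: HS; constructor 1.
have Hx1 : H (within [:: true] xmap) by apply: HS; constructor 2.
have Hy : H (within [:: true; false] ymap) by apply: HS; constructor 3.
have Hx' := pgV gH Hx inv_of_x; have Hx1' := pgV gH Hx1 (inv_of_xs _).
have := xx_relation [::]; rewrite within_nil /= => R0.
have Hx0 : H (within [:: false] xmap).
  have -> : within [:: false] xmap =
      xinv ** within [:: true] xinv ** (within [:: true] xmap ** xmap ** within [:: false] xmap).
    have ? := inv_of_x; have ? := inv_of_xs [:: true]; group_eq.
  by rewrite -R0; group_mem gH.
have Hx1n n : H (within (nseq n.+1 true) xmap).
  by elim: n => // n IH; rewrite -conj_x1; group_mem gH.
have Hx0n n : H (within (nseq n.+1 false) xmap).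
  by elim: n => // n IH; rewrite -conj_x0; group_mem gH.
have Hx10 : H (within [:: true; false] xmap).
  have R1 := xx_relation [:: true].
  have Hx11' := pgV gH (Hx1n 1) (inv_of_xs _).
  have -> : within [:: true; false] xmap = within [:: true] xinv ** within [:: true; true] xinv **
      (within [:: true; true] xmap ** within [:: true] xmap ** within [:: true; false] xmap).
    have ? := inv_of_xs [:: true; true]; have ? := inv_of_xs [:: true]; group_eq.
  by rewrite -R1; group_mem gH.
have Hnc s u : ~~ constant_word s -> H (within [:: true; false] u) -> H (within s u).
  move=> ns Hu; have [f Hf fE] := word_move gH Hx Hx0 Hx1 ns.
  have [f' ff] := pgI gH Hf; have /inv_ofP[fK _] := ff.
  rewrite -(@conj_within f' f [:: true; false] s u) => [||xi]; [|exact: inv_ofC|by rewrite -fE fK].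
  by group_mem gH; apply: (pgV gH) ff.
apply: (gen_by_min gH) => f [s [|[ns]] ->]; last exact: Hnc.
have [cs|] := boolP (constant_word s); last by move=> /Hnc; apply.
have [b ->] := constant_wordE cs; case: (size s) => [|n]; first by rewrite [xs _]within_nil.
by case: b; [apply: Hx1n | apply: Hx0n].
Qed.

(** Conjugation by x reaches every nonempty constant address from y_0 and y_1; y at the empty word
    then follows from [y_relation]. *)
Lemma G_gens (H : perm -> Prop) : perm_group H -> (forall f, gens f -> H f) ->
  forall f, G f -> H f.
Proof.
move=> gH HS.
have H0 f : G0 f -> H f by apply: G0_gens0 => // g g0; apply: HS; constructor 1.
have Hx : H xmap by apply: HS; do 2!constructor 1.
have Hx' := pgV gH Hx inv_of_x.
have H1 n : H (within (nseq n.+1 true) ymap).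
  elim: n => [|n IH]; first by apply: HS; constructor 3.
  by rewrite -conj_x1; group_mem gH.
have H2 n : H (within (nseq n.+1 false) ymap).
  elim: n => [|n IH]; first by apply: HS; constructor 2.
  by rewrite -conj_x0; group_mem gH.
apply: (gen_by_min gH) => f [s [] ->]; first exact: H0 (xs s) (G0_xs s).
have [cs|/G0_ys/H0 //] := boolP (constant_word s).
have [b ->] := constant_wordE cs; case: (size s) => [|n]; last first.
  by case: b; [apply: H1 | apply: H2].
have := y_relation [::]; rewrite within_nil [ys _]within_nil /= => ->.
rewrite within_nil; group_mem gH; [exact: (H2 0)| |exact: (H1 1)].
by apply: (pgV gH) (inv_of_ys _); apply: H0; apply: G0_ys.
Qed.

(** * Neighbourhoods of the two ends *)

Definition cconst (b : bool) : cantor := fun _ => b.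

Definition ends n (xi : cantor) : Prop := exists b, cone (nseq n b) xi.

Lemma cconstE b : cconst b = b |> cconst b.
Proof. by apply: functional_extensionality => -[|n]; rewrite cconsE. Qed.

(** Makes the ends into balls around the constant sequences, so that continuity at these fixed
    points controls them. *)
Lemma cone_nseq n b xi : cone (nseq n b) xi <-> agree n xi (cconst b).
Proof.
elim: n xi => [|n IH] xi; first by split=> // _; exists xi; rewrite lapp_nil.
have [c [eta ->]] := cconsP xi; rewrite cconstE agree_ccons -IH.
split=> [[zeta]|[-> [zeta ->]]]; last by exists zeta; rewrite lapp_cons.
by rewrite lapp_nseqSr => /ccons_inj[-> ->]; split=> //; exists zeta.
Qed.

Lemma cone_nseq_le m n b xi : m <= n -> cone (nseq n b) xi -> cone (nseq m b) xi.
Proof. by move=> mn /cone_nseq A; apply/cone_nseq; apply: agreeW A. Qed.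

Lemma ends_le m n xi : m <= n -> ends n xi -> ends m xi.
Proof. by move=> mn [b /(cone_nseq_le mn)]; exists b. Qed.

Lemma within_cconst s f b : f (cconst b) = cconst b -> within s f (cconst b) = cconst b.
Proof.
move=> fb; elim: s => [|c s IH]; first by rewrite within_nil.
by rewrite [in LHS]cconstE within_cons IH if_same -cconstE.
Qed.

Lemma xmap_cconst b : xmap (cconst b) = cconst b.
Proof. by case: b; rewrite [in LHS]cconstE; [|rewrite [in LHS]cconstE]; rewrite xE -!cconstE. Qed.

Lemma ymap_cconst b : ymap (cconst b) = cconst b.
Proof.
apply: agree_eq; elim=> // n IH; rewrite cconstE.
case: b IH => IH; last by rewrite [in ymap _]cconstE ymap00; apply/agree_ccons.
by rewrite ymap1; apply/agree_ccons; split=> //; rewrite [in X in agree _ _ X]cconstE;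
    apply: agree_cons.
Qed.

Lemma G_continuous f : G f -> ucont f /\ forall b, f (cconst b) = cconst b.
Proof.
(* Continuity of the inverse is carried along to make the property closed under inversion. *)
pose H g := [/\ ucont g, forall b, g (cconst b) = cconst b & exists2 h, inv_of h g & ucont h].
suff HG : forall g, G g -> H g by move=> /HG[].
have gH : perm_group H.
  split.
  - by split; [apply: ucont_id | | exists pid => //; apply: ucont_id].
  - move=> g h [gc gb [g' gg gc']] [hc hb [h' hh hc']]; split; first exact: ucont_comp.
    + by move=> b; rewrite /pcomp hb gb.
    + by exists (h' ** g'); [apply: inv_of_comp | apply: ucont_comp].
  - move=> g h [gc gb [g' gg gc']] hg; have -> := inv_of_uniq hg gg; split=> //.
    + by move=> b; have /inv_ofP[gK _] := gg; rewrite -{1}(gb b) gK.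
    + by exists g => //; apply: inv_ofC.
  - by move=> g [_ _ [h hg _]]; exists h.
apply: (gen_by_min gH) => g [s [] ->]; split.
- by apply: ucont_within; apply: ucont_xmap.
- by move=> b; apply: within_cconst; apply: xmap_cconst.
- by exists (within s xinv); [apply: inv_of_xs | apply: ucont_within ucont_xinv].
- by apply: ucont_within; apply: ucont_ystate.
- by move=> b; apply: within_cconst; apply: ymap_cconst.
- by exists (within s yinv); [apply: inv_of_ys | apply: ucont_within (ucont_ystate _)].
Qed.

Lemma G_ends f n : G f -> exists m, forall xi, ends m xi -> ends n (f xi).
Proof.
move=> /G_continuous[fc fb]; have [m fm] := fc n; exists m => xi [b /cone_nseq A].
by exists b; apply/cone_nseq; rewrite -(fb b); apply: fm.
Qed.

Definition fixes_ends n (f : perm) : Prop := forall xi, ends n xi -> f xi = xi.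

Lemma fixes_endsW m n f : m <= n -> fixes_ends m f -> fixes_ends n f.
Proof. by move=> mn fm xi /(ends_le mn)/fm. Qed.

Lemma fixes_ends_inv n f f' : inv_of f' f -> fixes_ends n f -> fixes_ends n f'.
Proof. by move=> /inv_ofP[fK _] fn xi /fn E; rewrite -{1}E fK. Qed.

Lemma lapp_nseqC m n b xi :
  lapp (nseq m b) (lapp (nseq n b) xi) = lapp (nseq n b) (lapp (nseq m b) xi).
Proof. by rewrite -!lapp_cat -!nseqD addnC. Qed.

(** True of the three generators, and such prefix replacements compose because powers of one letter
    commute. It would fail for y_1, since y sends 1^n xi to 1^{2n} y(xi). *)
Lemma G0_germ b f : G0 f ->
  exists p q, forall xi, f (lapp (nseq p b) xi) = lapp (nseq q b) xi.
Proof.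
pose H g := G0 g /\ exists p q, forall xi, g (lapp (nseq p b) xi) = lapp (nseq q b) xi.
suff HG : forall g, G0 g -> H g by move=> /HG[].
apply: G0_gens0.
- split.
  + by split; [apply: gen_id | exists 0, 0].
  + move=> g h [Gg [p [q gE]]] [Gh [r [s hE]]]; split; first exact: gen_comp.
    exists (r + p), (s + q) => xi; rewrite !nseqD !lapp_cat /pcomp hE.
    by rewrite lapp_nseqC gE lapp_nseqC.
  + move=> g h [Gg [p [q gE]]] hg; split; first exact: gen_inv hg.
    by exists q, p => xi; have /inv_ofP[gK _] := hg; rewrite -gE gK.
  + by move=> g [/(pgI G0_group)].
- move=> g Sg; split; first exact: gens0_G0.
  clear H; case: Sg => ->; case: b.
  + by exists 1, 2 => xi; rewrite !lapp_cons lapp_nil !xE.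
  + by exists 2, 1 => xi; rewrite !lapp_cons lapp_nil !xE.
  + by exists 2, 3 => xi; rewrite !lapp_cons lapp_nil !within_cons /= within_nil !xE.
  + by exists 1, 1 => xi; rewrite !lapp_cons lapp_nil !within_cons.
  + by exists 2, 2 => xi; rewrite !lapp_cons lapp_nil !within_cons /= ?within_cons.
  + by exists 1, 1 => xi; rewrite !lapp_cons lapp_nil !within_cons.
Qed.

Notation K := (derived G0).

Lemma K_group : perm_group K. Proof. exact: derived_group G0_group. Qed.
Lemma K_G0 f : K f -> G0 f. Proof. exact: derived_sub G0_group f. Qed.
Lemma K_G f : K f -> G f. Proof. by move/K_G0/G0_G. Qed.

(** Near an end the elements of [G0] act as shifts, hence commute there. *)
Lemma K_fixes_ends k : K k -> exists n, fixes_ends n k.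
Proof.
pose N g := G0 g /\ exists n, fixes_ends n g.
suff KN : forall g, K g -> N g by move/KN => [].
apply: derived_min.
- split.
  + by split; [apply: gen_id | exists 0].
  + move=> g h [Gg [m gm]] [Gh [n hn]]; split; first exact: gen_comp.
    exists (maxn m n) => xi E; rewrite /pcomp hn ?gm //; apply: ends_le E; lia.
  + move=> g h [Gg [m gm]] hg; split; first exact: gen_inv hg.
    by exists m; apply: fixes_ends_inv hg gm.
  + by move=> g [/(pgI G0_group)].
- move=> a b a' b' Ga Gb aa bb; split; first exact: (commutator_closed G0_group).
  have germ c : exists n, forall xi, cone (nseq n c) xi -> commutator a' b' a b xi = xi.
    have [p [q aE]] := G0_germ c Ga; have [r [s bE]] := G0_germ c Gb.
    (* Depth r + p leaves room to apply the two maps in either order. *)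
    exists (r + p) => _ [xi ->].
    have abE : a (b (lapp (nseq (r + p) c) xi)) = b (a (lapp (nseq (r + p) c) xi)).
      rewrite !nseqD !lapp_cat bE (lapp_nseqC r) aE (lapp_nseqC s) aE.
      by rewrite [in RHS](lapp_nseqC q) bE lapp_nseqC.
    rewrite /commutator /pcomp abE.
    by have [/inv_ofP[aK _] /inv_ofP[bK _]] := (aa, bb); rewrite bK aK.
  have [[m fm] [n fn]] := (germ false, germ true).
  exists (maxn m n) => xi [] [] /cone_nseq_le E; [apply: fn | apply: fm]; apply: E; lia.
Qed.

(** * Elements of G agree with elements of K away from the ends *)

Lemma K_normal_G0 : normalizes G0 K.
Proof. exact: derived_normalizes G0_group (group_normalizes G0_group). Qed.

Lemma G0_x : G0 xmap. Proof. by apply: gens0_G0; constructor 1. Qed.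

Lemma nseq_conj b u n : exists h h', [/\ G0 h, inv_of h' h &
  within (nseq n.+1 b) u = h ** (within [:: b] u ** h')].
Proof.
elim: n => [|n [h [h' [Gh hh E]]]]; first by exists pid, pid; split; first exact: gen_id.
case: b E => E.
- exists (xmap ** h), (h' ** xinv); split; last by rewrite -conj_x1 E.
    by apply: gen_comp => //; apply: G0_x.
  by apply: inv_of_comp => //; apply: inv_of_x.
- exists (xinv ** h), (h' ** xmap); split; last by rewrite -conj_x0 E.
    by apply: gen_comp => //; apply: gen_inv G0_x inv_of_x.
  by apply: inv_of_comp => //; apply: inv_ofC inv_of_x.
Qed.

(** A power of x conjugates the copy of u at b to the copy at b^{n+1}, so this product is a
    commutator. It acts as the copy of u wherever the image stays off the deep cone. *)
Lemma K_tail b u u' n : inv_of u' u -> G0 (within [:: b] u) ->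
  K (within (nseq n.+1 b) u' ** within [:: b] u).
Proof.
move=> uu Gu; have [h [h' [Gh hh ->]]] := nseq_conj b u' n.
have iu := inv_of_within [:: b] uu.
have -> : h ** (within [:: b] u' ** h') ** within [:: b] u =
   commutator h (within [:: b] u') h' (within [:: b] u) by [].
by apply: derived_commutator => //; [apply: gen_inv hh | apply: inv_ofC].
Qed.

Definition approx (f : perm) : Prop :=
  forall n, exists2 k, K k & forall xi, ~ ends n xi -> k xi = f xi.

Lemma inv_not_ends f f' m n xi : inv_of f' f ->
  (forall xi, ends m xi -> ends n (f' xi)) -> ~ ends n xi -> ~ ends m (f xi).
Proof. by move=> /inv_ofP[fK _] H nE /H; rewrite fK. Qed.

Lemma approx_tail u u' : inv_of u' u -> G0 (within [:: true] u) -> approx (within [:: true] u).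
Proof.
move=> uu Gu n; have iu := inv_of_within [:: true] uu.
have [|m mE] := @G_ends (within [:: true] u') n; first by apply/G0_G/(pgV G0_group Gu).
exists (within (nseq m.+1 true) u' ** within [:: true] u); first exact: K_tail.
move=> xi nE; rewrite /pcomp within_out // => /(cone_nseq_le (leqnSn m)) C.
by apply: (inv_not_ends iu mE nE); exists true.
Qed.

Lemma approx_x : approx xmap.
Proof.
move=> n; have [m mE] : exists m, forall xi, ends m xi -> ends n (xinv xi).
  by apply: G_ends; apply/G0_G/(pgV G0_group G0_x inv_of_x).
(* For xi off the n-th ends, the cut-off factor at the zeros is then trivial at xi, and the one at
   the ones is trivial at x(xi). *)
pose p := maxn m n.
have := xx_relation [::]; rewrite within_nil /= => R.
have ix0 := inv_of_xs [:: false]; have ix1 := inv_of_xs [:: true]; have ix := inv_of_x.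
exists (within (nseq p.+1 true) xinv ** xmap ** within (nseq p.+1 false) xinv).
  (* The outer factors come from [K_tail]. The middle one is a commutator of x and x_0, equal to
     x_1^{-1} x x_0^{-1} by the relation x^2 = x_1 x x_0. *)
  have -> : within (nseq p.+1 true) xinv ** xmap ** within (nseq p.+1 false) xinv =
     (within (nseq p.+1 true) xinv ** within [:: true] xmap)
     ** (commutator xmap (within [:: false] xmap) xinv (within [:: false] xinv))
     ** (within [:: false] xmap ** ((within (nseq p.+1 false) xinv ** within [:: false] xmap)
                                    ** within [:: false] xinv)).
    have E : xmap ** within [:: false] xmap ** xinv = within [:: true] xinv ** xmap.
      have -> : within [:: true] xinv ** xmap = within [:: true] xinv ** (xmap ** xmap) ** xinv
        by group_eq.
      by rewrite R; group_eq.
    have -> : commutator xmap (within [:: false] xmap) xinv (within [:: false] xinv)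
      = (xmap ** within [:: false] xmap ** xinv) ** within [:: false] xinv by [].
    by rewrite E; group_eq.
  apply: (pgM K_group); [apply: (pgM K_group)|].
  - by exact: (K_tail p inv_of_x (G0_xs _)).
  - apply: derived_commutator; [|apply: gen_inv ix0; apply: G0_xs| |exact: inv_ofC].
      exact: gen_inv G0_x ix.
    exact: inv_ofC.
  - by apply: (K_normal_G0 (G0_xs _) ix0); exact: (K_tail p inv_of_x (G0_xs _)).
move=> xi nE; rewrite /pcomp [X in xmap X]within_out.
  rewrite within_out // => C; apply: (inv_not_ends ix mE nE); exists true.
  by apply: cone_nseq_le C; lia.
by move=> C; apply: nE; exists false; apply: cone_nseq_le C; lia.
Qed.

(** For a composite, the outer map is approximated at a depth m such that the inner map keeps points
    off the n-th ends off the m-th ones. *)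
Lemma approx_group : perm_group (fun f => G f /\ approx f).
Proof.
split.
- by split; [apply: gen_id | move=> n; exists pid; first exact: gen_id].
- move=> f g [Gf Af] [Gg Ag]; split; first exact: gen_comp.
  move=> n; have [g' gg] := pgI G_group Gg.
  have [m mE] := G_ends n (pgV G_group Gg gg).
  have [h Kh hE] := Af m; have [k Kk kE] := Ag n.
  exists (h ** k); first exact: gen_comp.
  by move=> xi nE; rewrite /pcomp kE // hE //; apply: inv_not_ends gg mE nE.
- move=> f g [Gf Af] gf; split; first exact: gen_inv gf.
  move=> n; have [m mE] := G_ends n Gf; have [k Kk kE] := Af m.
  have [k' kk] := pgI K_group Kk; exists k'; first exact: (pgV K_group) kk.
  move=> xi nE; have /inv_ofP[_ gK] := gf; have /inv_ofP[kK _] := kk.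
  rewrite -{1}(gK xi) -kE ?kK //.
  by apply: (inv_not_ends (inv_ofC gf) mE nE).
- by move=> f [/(pgI G_group)].
Qed.

Lemma approx_G0 f : G0 f -> approx f.
Proof.
move=> Gf; suff [] : G f /\ approx f by [].
apply: (G0_gens0 approx_group) Gf => g Sg; split; first exact/G0_G/gens0_G0.
case: Sg => ->; first exact: approx_x.
  by apply: approx_tail inv_of_x (G0_xs _).
rewrite -[[:: true; false]]/([:: true] ++ [:: false]) within_cat.
by apply: approx_tail (inv_of_ys _) _; rewrite -within_cat; apply: G0_ys.
Qed.

(** Expresses y_1 through its own conjugate y_111, all other factors lying in [G0]. Repeated
    substitution pushes the part outside [G0] towards 1^oo. *)
Lemma y1_expand : within [:: true] ymap =
  within [:: true; false] ymap ** within [:: true; true; false] yinv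
   ** xmap ** xmap ** within [:: true] ymap ** xinv ** xinv ** within [:: true] xmap.
Proof.
rewrite {1}y_relation /= -[[:: true; true; true]]/(nseq 3 true) -conj_x1.
by rewrite -(conj_x1 0).
Qed.

Lemma y0_expand : within [:: false] ymap =
  xinv ** within [:: false] ymap ** xmap ** within [:: false; true; false] yinv
   ** within [:: false; true; true] ymap ** within [:: false] xmap.
Proof.
by rewrite {1}y_relation /= -[[:: false; false]]/(nseq 2 false) -conj_x0.
Qed.

Lemma approx_y1 : approx (within [:: true] ymap).
Proof.
suff H n : exists2 g, G0 g &
    forall xi, ~ cone (nseq n.+1 true) xi -> g xi = within [:: true] ymap xi.
  move=> n; have [g /approx_G0/(_ n)[k Kk kE] gE] := H n; exists k => // xi nE.
  rewrite kE // gE // => C; apply: nE; exists true; exact: cone_nseq_le C.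
elim: n => [|n [g Gg gE]].
  by exists pid; [apply: gen_id | move=> xi nC; rewrite within_out].
exists (within [:: true; false] ymap ** within [:: true; true; false] yinv
   ** xmap ** xmap ** g ** xinv ** xinv ** within [:: true] xmap).
  have ? := G0_x; have ? := G0_xs [:: true]; have ? := pgV G0_group G0_x inv_of_x.
  group_mem G0_group; first exact: G0_ys.
  by apply: (pgV G0_group) (inv_of_ys _); apply: G0_ys.
move=> xi nC; rewrite [in RHS]y1_expand /pcomp gE // => -[eta E]; apply: nC.
have /inv_ofP[_ xK] := inv_of_x; have /inv_ofP[x1K _] := inv_of_xs [:: true].
(* Two ones are removed by x^{-2} and one is added by x_1, so the bad cone shrinks by one letter. *)
have {}E : within [:: true] xmap xi = lapp (nseq n.+3 true) eta.
  by rewrite -(xK (within _ _ _)) -(xK (xinv _)) E !lapp_nseqSr !xE.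
exists eta; rewrite -(x1K xi) E !lapp_nseqSr within_cons /= within_nil.
by rewrite xE.
Qed.

Lemma approx_y0 : approx (within [:: false] ymap).
Proof.
suff H n : exists2 g, G0 g &
    forall xi, ~ cone (nseq n.+1 false) xi -> g xi = within [:: false] ymap xi.
  move=> n; have [g /approx_G0/(_ n)[k Kk kE] gE] := H n; exists k => // xi nE.
  rewrite kE // gE // => C; apply: nE; exists false; exact: cone_nseq_le C.
elim: n => [|n [g Gg gE]].
  by exists pid; [apply: gen_id | move=> xi nC; rewrite within_out].
exists (xinv ** g ** xmap ** within [:: false; true; false] yinv
   ** within [:: false; true; true] ymap ** within [:: false] xmap).
  have ? := G0_x; have ? := G0_xs [:: false]; have ? := pgV G0_group G0_x inv_of_x.
  group_mem G0_group; last exact: G0_ys.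
  by apply: (pgV G0_group) (inv_of_ys _); apply: G0_ys.
move=> xi nC; rewrite [in RHS]y0_expand /pcomp gE // => -[eta E]; apply: nC.
have /inv_ofP[xK _] := inv_of_x; have /inv_ofP[x0K _] := inv_of_xs [:: false].
have /inv_ofP[y1K _] := inv_of_ys [:: false; true; true].
have /inv_ofP[_ y0K] := inv_of_ys [:: false; true; false].
(* Both x and x_0 remove a zero, so xi starts with n+3 zeros, one more than required. *)
exists (false |> eta).
rewrite -(x0K xi) -(y1K (within _ xmap xi)) -(y0K (within _ ymap _)) -(xK (within [:: false;
    true; false] yinv _)) E.
rewrite !lapp_nseqSr xE; do 3!rewrite ?within_cons /=; rewrite within_nil.
by rewrite -lapp_nseqS !lapp_nseqSr xE.
Qed.

Lemma approx_G f : G f -> approx f.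
Proof.
move=> Gf; suff [] : G f /\ approx f by [].
apply: (G_gens approx_group) Gf => g Sg; split; first exact: gens_G.
by case: Sg => [/gens0_G0/approx_G0|->|->] //; [apply: approx_y0 | apply: approx_y1].
Qed.

(** If g fixes the n-th ends and k in K agrees with f off them, then f g f^{-1} = k g k^{-1}. *)
Lemma K_normal_G : normalizes G K.
Proof.
move=> f f' g Gf ff Kg; have [n gn] := K_fixes_ends Kg.
have [k Kk kE] := approx_G Gf n; have [k' kk] := pgI K_group Kk.
suff -> : f ** (g ** f') = k ** (g ** k') by apply: (group_normalizes K_group).
have /inv_ofP[fK fK'] := ff; have /inv_ofP[kK kK'] := kk; have [g' gg] := pgI K_group Kg.
have gn' := fixes_ends_inv gg gn; have /inv_ofP[gK _] := gg.
have out xi : ~ ends n xi -> ~ ends n (g xi).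
  by move=> nE E; apply: nE; rewrite -(gK xi) gn'.
apply: functional_extensionality => xi; rewrite /pcomp.
have [E|nE] := classic (ends n (f' xi)); last first.
  have Ek : k' xi = f' xi by rewrite -{1}(fK' xi) -kE // kK.
  by rewrite Ek kE //; apply: out.
have [E'|nE'] := classic (ends n (k' xi)); first by rewrite !gn // fK' kK'.
by move: E; rewrite -{1}(kK' xi) kE // fK => /nE'.
Qed.

(** * Commutators in normalized subgroups *)

(** For m at least 2, x_0 x_1^{-1} maps the complement of the (m+1)-th ends into that of the m-th.
    The last complement, the cones at 01 and 10, goes into the cone at 10 by x_1^{-1} x. *)
Lemma G0_compress n : exists2 h, G0 h & forall xi, ~ ends n.+2 xi -> cone [:: true; false] (h xi).
Proof.
have [h Gh hE] : exists2 h, G0 h & forall xi, ~ ends n.+2 xi -> ~ ends 2 (h xi).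
  elim: n => [|n [h Gh hE]]; first by exists pid; first exact: gen_id.
  have i0 := inv_of_xs [:: false]; have i1 := inv_of_xs [:: true].
  exists (h ** (within [:: false] xmap ** within [:: true] xinv)).
    apply: (pgM G0_group) => //; apply: (pgM G0_group); first exact: G0_xs.
    exact: (pgV G0_group (G0_xs _) i1).
  move=> xi nE; apply: hE.
  have i01 := inv_of_comp i0 (inv_ofC i1); apply: (inv_not_ends i01) nE => zeta.
  case=> -[] [eta ->]; rewrite !lapp_nseqSr /pcomp; do 2!rewrite ?within_cons ?within_nil ?xE /=.
  - by exists true, eta; rewrite !lapp_nseqSr.
  - by exists false, eta; rewrite !lapp_nseqSr.
have i1 := inv_of_xs [:: true].
exists (within [:: true] xinv ** xmap ** h).
  apply: (pgM G0_group) => //; apply: (pgM G0_group); last exact: G0_x.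
  exact: (pgV G0_group (G0_xs _) i1).
move=> xi /hE; rewrite /pcomp; move: (h xi) => zeta.
have [b [eta ->]] := cconsP zeta; have [c [theta ->]] := cconsP eta.
case: b; case: c => nE.
- by case: nE; exists true, theta; rewrite !lapp_cons lapp_nil.
- by rewrite xE within_cons within_nil xE; exists (true |> theta); rewrite !lapp_cons lapp_nil.
- by rewrite xE within_cons within_nil xE; exists (false |> theta); rewrite !lapp_cons lapp_nil.
- by case: nE; exists false, theta; rewrite !lapp_cons lapp_nil.
Qed.

Lemma G0_word_move s t : ~~ constant_word s -> ~~ constant_word t ->
  exists2 f, G0 f & forall xi, f (lapp s xi) = lapp t xi.
Proof.
move=> /(word_move G0_group G0_x (G0_xs _) (G0_xs _))[f Gf fE].
move=> /(word_move G0_group G0_x (G0_xs _) (G0_xs _))[g Gg gE].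
have [g' gg] := pgI G0_group Gg; have /inv_ofP[gK _] := gg.
exists (g' ** f); first by apply: gen_comp => //; apply: gen_inv gg.
by move=> xi; rewrite /pcomp fE -gE gK.
Qed.

Lemma K_compress n s : ~~ constant_word s ->
  exists2 k, K k & forall xi, ~ ends n xi -> cone s (k xi).
Proof.
move=> ns; have [h Gh hE] := G0_compress n.
have [|f Gf fE] := @G0_word_move [:: true; false] s _ ns; first by [].
have /approx_G/(_ n.+2)[k Kk kE] : G (f ** h) by apply/G0_G/gen_comp.
have nle xi : ~ ends n xi -> ~ ends n.+2 xi by move=> nE E; apply: nE; apply: ends_le E; lia.
exists k => // xi /nle nE; rewrite kE // /pcomp; have [eta ->] := hE _ nE.
by exists eta; rewrite fE.
Qed.

Lemma agree_cprefix p t xi eta : agree p (lapp (cprefix xi p ++ t) eta) xi.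
Proof.
move=> i ip; rewrite lapp_cat {1}/lapp size_map size_iota ip.
by rewrite (nth_map 0) ?size_iota // nth_iota.
Qed.

Lemma displaced_cone f : G f -> f <> pid ->
  exists2 s, ~~ constant_word s & forall xi, cone s xi -> ~ cone s (f xi).
Proof.
move=> /G_continuous[fc _] fN.
have [xi fxi] : exists xi, f xi <> xi.
  apply: NNPP => nE; apply: fN; apply: functional_extensionality => xi.
  by apply: NNPP => ne; apply: nE; exists xi.
have [i ne] : exists i, f xi i <> xi i.
  apply: NNPP => nE; apply: fxi; apply: functional_extensionality => i.
  by apply: NNPP => ne; apply: nE; exists i.
have [m mE] := fc i.+1; pose p := maxn m i.+1.
(* The letter at position i already separates this cone from its image; the suffix 01 makes the word
   non-constant. *)
exists (cprefix xi p ++ [:: false; true]).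
  by rewrite /constant_word !mem_cat !inE !orbT.
move=> _ [eta ->] [zeta E]; apply: ne.
have A := @agree_cprefix p [:: false; true] xi.
rewrite -(mE (lapp (cprefix xi p ++ [:: false; true]) eta) xi) //; last first.
  by apply: agreeW (A eta); rewrite leq_maxl.
by rewrite E A // leq_maxr.
Qed.

Lemma disjoint_commute (U : cantor -> Prop) u u' g g' : inv_of u' u -> inv_of g' g ->
    (forall xi, U xi -> u xi = xi) -> (forall xi, ~ U xi -> g xi = xi) ->
  u ** g = g ** u.
Proof.
move=> /inv_ofP[uK _] /inv_ofP[gK _] uU gU.
apply: functional_extensionality => xi; rewrite /pcomp.
have [Ux|nUx] := classic (U xi).
  have [Ug|nUg] := classic (U (g xi)); first by rewrite !uU.
  by have E := gU _ nUg; have Exi := gK (g xi); rewrite E gK in Exi; rewrite -Exi in nUg.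
have [Uu|nUu] := classic (U (u xi)); last by rewrite (gU _ nUx) (gU _ nUu).
by have E := uU _ Uu; have Exi := uK (u xi); rewrite E uK in Exi; rewrite -Exi in Uu.
Qed.

(** With [D = [f, g]] in [N], the commutator [[D, h]] lies in [N]; as [g] and
    its conjugate by [f] have disjoint supports, it equals [[g, h]]. *)
Lemma double_commutator (M N U : _ -> Prop) f g h g' h' :
    perm_group M -> perm_group N -> normalizes M N -> N f -> M g -> M h ->
    inv_of g' g -> inv_of h' h -> (forall xi, U xi -> ~ U (f xi)) ->
    (forall xi, ~ U xi -> g xi = xi) -> (forall xi, ~ U xi -> h xi = xi) ->
  N (commutator g' h' g h).
Proof.
move=> gM gN nMN Nf Mg Mh gg hh fU gU hU; have [f' ff] := pgI gN Nf.
have Mg' := pgV gM Mg gg; have Mh' := pgV gM Mh hh; have Nf' := pgV gN Nf ff.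
have ig := inv_ofC gg; have ih := inv_ofC hh.
pose u := f' ** (g' ** f); pose u' := f' ** (g ** f).
have uu : inv_of u' u by split; rewrite /u /u'; group_eq.
have uU xi : U xi -> u xi = xi.
  move=> /fU/gU E; rewrite /u /pcomp -{1}E.
  by move: gg ff => /inv_ofP[gK _] /inv_ofP[fK _]; rewrite gK fK.
have h'U xi : ~ U xi -> h' xi = xi.
  by move=> /hU E; rewrite -{1}E; move: hh => /inv_ofP[-> _].
have uh := disjoint_commute uu ih uU h'U.
have ND : N (u ** g).
  have -> : u ** g = f' ** (g' ** (f ** g)) by [].
  by apply: (pgM gN) => //; apply: nMN.
have [D' DD] := pgI gN ND.
have ND' : N (D' ** (h' ** ((u ** g) ** h))).
  by apply: (pgM gN); [apply: (pgV gN) DD | apply: nMN].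
have ED : D' = g' ** u' by apply: inv_of_uniq DD _; apply: inv_of_comp.
suff -> : commutator g' h' g h = D' ** (h' ** ((u ** g) ** h)) by [].
rewrite ED; have -> : h' ** (u ** g ** h) = (h' ** u) ** g ** h by [].
by rewrite -uh; clearbody u u'; group_eq.
Qed.

(** Some k in K carries the supports of g and h into a cone displaced by an element of N.
    [double_commutator] applies to the conjugates, and conjugating by k^{-1} returns to g and h. *)
Lemma small_commutators (M N : perm -> Prop) :
    perm_group M -> (forall k, K k -> M k) -> (forall f, N f -> G f) ->
    perm_group N -> normalizes M N -> ~ trivial N ->
  forall n g h g' h', M g -> M h -> fixes_ends n g -> fixes_ends n h ->
    inv_of g' g -> inv_of h' h -> N (commutator g' h' g h).
Proof.
move=> gM KM NG gN nMN Nnt n g h g' h' Mg Mh gn hn gg hh.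
have [f Nf fN] : exists2 f, N f & f <> pid.
  apply: NNPP => nE; apply: Nnt => f Nf; apply: NNPP => fN; apply: nE.
  by exists f.
have [s ns sE] := displaced_cone (NG _ Nf) fN.
have [k Kk kE] := K_compress n ns; have [k' kk] := pgI K_group Kk.
have Mk := KM _ Kk; have Mk' := pgV gM Mk kk.
have fix_out u xi : fixes_ends n u -> ~ cone s xi -> (k ** (u ** k')) xi = xi.
  have /inv_ofP[_ kK'] := kk; move=> un nC; rewrite /pcomp un //.
  by apply: NNPP => /kE; rewrite kK'.
have C : N (commutator (k ** (g' ** k')) (k ** (h' ** k')) (k ** (g ** k')) (k ** (h ** k'))).
  apply: (double_commutator (U := cone s) gM gN nMN Nf) => //.
  - by group_mem gM.
  - by group_mem gM.
  - by split; group_eq.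
  - by split; group_eq.
  - by move=> xi; apply: fix_out.
  - by move=> xi; apply: fix_out.
have := nMN _ _ _ Mk' (inv_ofC kk) C.
by congr N; group_eq.
Qed.

Lemma within_fixes_ends s u : ~~ constant_word s -> fixes_ends (size s) (within s u).
Proof.
move=> ns xi [b [eta E]]; apply: within_out => -[zeta Z]; case/negP: ns.
have := cprefix_lapp s zeta 0; rewrite -Z E.
have := cprefix_lapp (nseq (size s) b) eta 0; rewrite size_nseq => -> /=.
rewrite /cprefix /= !cats0 => <-; rewrite /constant_word !mem_nseq.
by case: b {E}; rewrite ?andbF.
Qed.

Lemma com_normalized (M N : perm -> Prop) m c : perm_group M -> perm_group N ->
  normalizes M N -> N m -> M c -> com N m c.
Proof.
move=> gM gN nMN Nm Mc; have [m' mm] := pgI gN Nm; have [c' cc] := pgI gM Mc.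
apply/(com_commutator N mm cc); apply: (pgM gN); first exact: (pgV gN) mm.
apply: nMN => //; [exact: (pgV gM) cc | exact: inv_ofC].
Qed.

Lemma com_refl N a : perm_group N -> com N a a.
Proof. by move=> gN; exists pid; first exact: pg1. Qed.

Lemma within_disjoint s t u v :
  within (true :: s) u ** within (false :: t) v = within (false :: t) v ** within (true :: s) u.
Proof.
apply: functional_extensionality => xi; rewrite /pcomp.
by have [[] [eta ->]] := cconsP xi; rewrite !within_cons.
Qed.

(** All [x_s] with [s] non-constant are equal modulo [N], so the relation
    [x_s^2 = x_s1 x_s x_s0] puts them in [N]; likewise all [y_s] agree modulo
    [N], and the generators then commute modulo [N]. *)
Lemma G0_abelian_quotient N : perm_group N -> normalizes G0 N ->
    (forall n g h g' h', G0 g -> G0 h -> fixes_ends n g -> fixes_ends n h ->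
       inv_of g' g -> inv_of h' h -> N (commutator g' h' g h)) ->
  forall a b a' b', G0 a -> G0 b -> inv_of a' a -> inv_of b' b ->
    N (commutator a' b' a b).
Proof.
move=> gN nN smallN.
(* This product is a commutator of the copy of u at s with an element of K moving s to t; both fix
   some ends. *)
have Nst s t u u' : ~~ constant_word s -> ~~ constant_word t -> inv_of u' u ->
    G0 (within s u) -> N (within s u' ** within t u).
  move=> ns nt uu Gu; have [m Gm mE] := G0_word_move ns nt.
  have [k Kk kE] := approx_G (G0_G Gm) (size s).
  have {}kE xi : k (lapp s xi) = lapp t xi.
    (* The point is off the ends: there a map supported in the cone at s would fix it, but flipping
       all letters after s moves it. *)
    rewrite kE ?mE // => /(@within_fixes_ends s (fun _ => negb \o xi) ns).
    rewrite within_lapp => /lapp_inj /(congr1 (@^~ 0)) /=.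
    by case: (xi 0).
  have [k' kk] := pgI K_group Kk; have [n kn] := K_fixes_ends Kk.
  rewrite -(conj_within u kk kE).
  have -> : within s u' ** (k ** (within s u ** k')) =
            commutator (within s u') k (within s u) k' by [].
  apply: (smallN (maxn n (size s))) => //.
  - exact: K_G0 (pgV K_group Kk kk).
  - exact: fixes_endsW (leq_maxr _ _) (within_fixes_ends u ns).
  - exact: fixes_endsW (leq_maxl _ _) (fixes_ends_inv kk kn).
  - exact: inv_of_within.
  - exact: inv_ofC.
have Nx s : ~~ constant_word s -> N (within s xmap).
  move=> ns.
  have nsb b : ~~ constant_word (s ++ [:: b]).
    move: ns; rewrite /constant_word !negbK !mem_cat => /andP[-> ->]; exact: isT.
  have iX := inv_of_xs s; have i1 := inv_of_xs (s ++ [:: true]).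
  have i0 := inv_of_xs (s ++ [:: false]).
  (* Solves x_s^2 = x_s1 x_s x_s0 for the middle x_s: it is x_s1^{-1} x_s times a conjugate of
     x_s0^{-1} x_s. *)
  have -> : within s xmap = (within (s ++ [:: true]) xinv ** within s xmap) **
     (within s xmap ** ((within (s ++ [:: false]) xinv ** within s xmap) ** within s xinv)).
    have -> : within (s ++ [:: true]) xinv ** within s xmap **
     (within s xmap ** (within (s ++ [:: false]) xinv ** within s xmap ** within s xinv)) =
      within (s ++ [:: true]) xinv ** (within s xmap ** within s xmap) **
        within (s ++ [:: false]) xinv by group_eq.
    by rewrite xx_relation; group_eq.
  apply: (pgM gN); first exact: Nst inv_of_x (G0_xs _).
  by apply: (nN _ _ _ (G0_xs s) iX); apply: Nst inv_of_x (G0_xs _).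
have ix := inv_of_x; have i1 := inv_of_xs [:: true].
have Gx' := pgV G0_group G0_x ix.
(* Here x x_1 x^{-1} = x_11, and the relation at 1 identifies x_11 with x_1 modulo x_10, which lies
   in N. *)
have C1 : com N xmap (within [:: true] xmap).
  have i10 := inv_of_xs [:: true; false]; have i11 := inv_of_xs [:: true; true].
  exists (xinv ** ((within [:: true] xmap **
    (within [:: true; false] xinv ** within [:: true] xinv)) ** xmap)).
    apply: (@nN) => //; [exact: inv_ofC|apply: (@nN) => //; first exact: G0_xs].
    by apply: (pgV gN) i10; apply: Nx.
  have E11 := conj_x1 0 xmap.
  transitivity (within [:: true; true] xmap ** xmap); first by rewrite -E11 /=; group_eq.
  have -> : within [:: true] xmap ** xmap ** (xinv ** (within [:: true] xmap **
    (within [:: true; false] xinv ** within [:: true] xinv) ** xmap)) =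
    (within [:: true] xmap ** within [:: true] xmap) ** within [:: true; false] xinv
      ** within [:: true] xinv ** xmap by group_eq.
  by rewrite xx_relation /=; group_eq.
have C2 : com N xmap (within [:: true; false] ymap).
  have iy := inv_of_ys [:: true; false].
  exists (xinv ** ((within [:: true; false] yinv ** within [:: true; true; false] ymap) ** xmap)).
    by apply: (@nN) => //; [exact: inv_ofC|apply: Nst inv_of_y (G0_ys _)].
  have <- : xmap ** (within [:: true; false] ymap ** xinv) = within [:: true; true; false] ymap.
    by apply: conj_within => // xi; rewrite !lapp_cons xE.
  by group_eq.
(* Modulo N, y_10 equals y_01, whose support is disjoint from that of x_1. *)
have C3 : com N (within [:: true] xmap) (within [:: true; false] ymap).
  have iy := inv_of_ys [:: false; true].
  apply: com_sym => //.
  have -> : within [:: true; false] ymap = within [:: false; true] ymap **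
     (within [:: false; true] yinv ** within [:: true; false] ymap) by group_eq.
  have N10 : N (within [:: false; true] yinv ** within [:: true; false] ymap).
    exact: Nst inv_of_y (G0_ys _).
  apply: (com_comp G0_group gN nN).
  - apply: (pgM G0_group); last exact: G0_ys.
    by apply: (pgV G0_group) iy; apply: G0_ys.
  - by exists pid; [apply: pg1 | rewrite -within_disjoint].
  - exact: com_normalized G0_group gN nN N10 (G0_xs _).
apply: (com_generators G0_group gN nN gens0_G0 G0_gens0) => a b.
by case=> ->; case=> -> //; try exact: com_refl; apply: com_sym.
Qed.

(** * The theorem for G0 *)

Lemma K'_nontrivial : ~ trivial (derived K).
Proof.
move=> triv.
have [k Kk kE] := approx_G (G0_G G0_x) 4.
have [l Kl lE] := approx_G (G0_G (G0_xs [:: true])) 4.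
have [k' kk] := pgI K_group Kk; have [l' ll] := pgI K_group Kl.
have kl : k ** l = l ** k.
  have /triv E := derived_commutator Kk Kl kk ll.
  have -> : k ** l = l ** k ** commutator k' l' k l by group_eq.
  by rewrite E.
(* x_1 fixes xi but moves x(xi) = 1001..., so x and x_1 do not commute there. Both points are off
   the 4-th ends, where k and l act as x and x_1. *)
pose xi := false |> true |> false |> cconst true.
have out (zeta : cantor) : (exists2 i, i < 4 & zeta i) -> (exists2 i, i < 4 & ~~ zeta i) ->
    ~ ends 4 zeta.
  by move=> [i i4 zi] [j j4 zj] [[]] /cone_nseq A; [rewrite A in zj | rewrite A in zi].
have := congr1 (@^~ xi) kl; rewrite /pcomp lE; last by apply: out; [exists 1|exists 0].
rewrite /xi within_cons /= kE; last by apply: out; [exists 1|exists 0].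
rewrite xE lE; last by apply: out; [exists 0|exists 1].
rewrite within_cons within_nil /= xE => /ccons_inj[_ /ccons_inj[_]].
by rewrite cconstE => /ccons_inj[].
Qed.

Lemma K_perfect f : K f -> derived K f.
Proof.
have gK' := derived_group K_group.
have nK' := derived_normalizes K_group K_normal_G0.
apply: derived_min => //; apply: G0_abelian_quotient => //.
apply: small_commutators K'_nontrivial => //; first exact: G0_group.
  exact: K_G0.
by move=> g /(derived_sub K_group)/K_G.
Qed.

Lemma K_simple : simple K.
Proof.
split=> [triv|N [sN nN]].
  by apply: K'_nontrivial => f /(derived_sub K_group)/triv.
have gN := subgroup_group K_group sN; have NK : forall f, N f -> K f by case: sN.
have [triv|ntriv] := classic (trivial N); [by left | right => f /K_perfect].
apply: derived_min f => // a b a' b' Ka Kb aa bb.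
have [[m am] [n bn]] := (K_fixes_ends Ka, K_fixes_ends Kb).
apply: (small_commutators K_group _ _ gN nN ntriv (n := maxn m n)) => //.
- by move=> f /NK/K_G.
- exact: fixes_endsW (leq_maxl _ _) am.
- exact: fixes_endsW (leq_maxr _ _) bn.
Qed.

Lemma nontrivial_quotient_abelian N : perm_group N -> (forall f, N f -> G f) ->
  normalizes G0 N -> ~ trivial N -> quot_abelian G0 N.
Proof.
move=> gN NG nN ntriv a b a' b'; apply: (G0_abelian_quotient gN nN).
exact: small_commutators G0_group K_G0 NG gN nN ntriv.
Qed.

(** * Powers and finite index subgroups *)

Fixpoint pow (f : perm) n : perm := if n is m.+1 then f ** pow f m else pid.

Lemma powD f m n : pow f (m + n) = pow f m ** pow f n.
Proof. by elim: m => // m IH; rewrite addSn /= IH. Qed.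

Lemma pow_mem H f n : perm_group H -> H f -> H (pow f n).
Proof. by move=> gH Hf; elim: n => [|n IH] /=; [apply: pg1 | apply: pgM]. Qed.

Lemma powM f m n : pow f (m * n) = pow (pow f m) n.
Proof. by elim: n => [|n IH]; rewrite ?muln0 // mulnS powD IH. Qed.

Lemma pow_conj f g g' n : inv_of g' g -> g ** (pow f n ** g') = pow (g ** (f ** g')) n.
Proof. by move=> gg; elim: n => [|n IH] /=; rewrite -?IH; group_eq. Qed.

Lemma pow_x_neq_id n : pow xmap n.+1 <> pid.
Proof.
have E m : pow xmap m (lapp [:: true] (cconst false)) = lapp (nseq m.+1 true) (cconst false).
  by elim: m => // m IH; rewrite [pow _ _]/= /pcomp IH !lapp_nseqSr xE.
move/(congr1 (@^~ (lapp [:: true] (cconst false)))); rewrite E.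
by rewrite /pid !lapp_nseqSr lapp_cons lapp_nil => /ccons_inj[_] /(congr1 (@^~ 0)); rewrite cconsE.
Qed.

(** With r cosets, two of q^0, ..., q^r share one, so H contains some q^d with 0 < d <= r, and d
    divides r!. This exponent serves all conjugates of x at once. *)
Lemma finite_index_pow H reps q : is_subgroup H G0 ->
    (forall i, i < size reps -> G0 (nth pid reps i)) ->
    (forall g, G0 g -> exists2 i, i < size reps &
       exists h, H h /\ g = nth pid reps i ** h) ->
  G0 q -> H (pow q (size reps)`!).
Proof.
move=> sH Greps repsP Gq; have gH := subgroup_group G0_group sH.
set r := size reps.
have /fin_all_exists[c cP] (i : 'I_r.+1) : exists j : 'I_r, exists h,
    H h /\ pow q i = nth pid reps j ** h.
  by have [j jr hP] := repsP _ (pow_mem i G0_group Gq); exists (Ordinal jr).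
have /injectivePn[i [j ij cij]] : ~~ injectiveb c.
  by apply/injectiveP => /leq_card; rewrite !card_ord ltnn.
wlog lt_ij : i j ij cij / i < j.
  move=> W; have [|ji|/val_inj E] := ltngtP i j; first exact: (W i j).
    by apply: (W j i) => //; rewrite eq_sym.
  by rewrite E eqxx in ij.
have [h [Hh hE]] := cP i; have [h2 [Hh2 hE2]] := cP j.
have [s' ss] := pgI G0_group (Greps _ (ltn_ord (c i))).
have [h' hh] := pgI gH Hh.
have E : pow q (j - i) = h' ** h2.
  have -> : h2 = s' ** pow q j by rewrite hE2 -cij; group_eq.
  by rewrite -(subnKC (ltnW lt_ij)) powD hE addKn; group_eq.
have /dvdnP[k ->] : j - i %| r`!.
  by apply: dvdn_fact; rewrite subn_gt0 lt_ij /=; have := ltn_ord j; lia.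
by rewrite mulnC powM; apply: pow_mem => //; rewrite E; apply: pgM => //; apply: (pgV gH) hh.
Qed.

Lemma finite_index_normal H : is_subgroup H G0 -> finite_index H G0 -> normal_in H G0.
Proof.
move=> sH [reps [Greps repsP]]; have gH := subgroup_group G0_group sH.
have HG0 f : H f -> G0 f by case: sH => HG _ _ _; apply: HG.
pose core f := G0 f /\ forall g g', G0 g -> inv_of g' g -> H (g ** (f ** g')).
have gcore : perm_group core.
  split.
  - split=> [|g g' Gg gg]; first exact: gen_id.
    have -> : g ** (pid ** g') = pid by group_eq.
    exact: pg1.
  - move=> f1 f2 [G1 H1] [G2 H2]; split=> [|g g' Gg gg]; first exact: gen_comp.
    have -> : g ** (f1 ** f2 ** g') = (g ** (f1 ** g')) ** (g ** (f2 ** g')) by group_eq.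
    by apply: (pgM gH); [apply: H1 | apply: H2].
  - move=> f1 f2 [G1 H1] f21; split=> [|g g' Gg gg]; first exact: gen_inv f21.
    by apply: (pgV gH (H1 g g' Gg gg)); split; group_eq.
  - by move=> f [/(pgI G0_group)].
have ncore : normalizes G0 core.
  move=> g g' f Gg gg [Gf Hf]; split=> [|k k' Gk kk].
    by apply: (group_normalizes G0_group).
  have -> : k ** (g ** (f ** g') ** k') = (k ** g) ** (f ** (g' ** k')) by [].
  by apply: Hf; [apply: gen_comp | apply: inv_of_comp].
(* Every conjugate of x has its r!-th power in H, so the core contains x^{r!}, which is not the
   identity. *)
have ntriv : ~ trivial core.
  move=> /(_ (pow xmap (size reps)`!)) T.
  have := fact_gt0 (size reps); case E: (size reps)`! T => [//|m] T _.
  apply: (@pow_x_neq_id m); apply: T; split=> [|g g' Gg gg].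
    exact: pow_mem G0_group G0_x.
  rewrite pow_conj // -E; apply: (finite_index_pow sH Greps repsP).
  by apply: (group_normalizes G0_group) => //; apply: G0_x.
have coreG f : core f -> G f by case=> /G0_G.
split=> // g g' h Gg gg Hh; have [h' hh] := pgI gH Hh.
have [_ C] := nontrivial_quotient_abelian gcore coreG ncore ntriv (HG0 _ Hh)
  (pgV G0_group Gg gg) hh (inv_ofC gg).
(* The commutator lies in the core; conjugating it by [pid] reads off that it lies in H. *)
have -> : g ** (h ** g') = h ** (pid ** (commutator h' g h g' ** pid)) by group_eq.
by apply: (pgM gH) => //; apply: C; [apply: gen_id | apply: inv_of_id].
Qed.

(** * The theorem for G *)

Notation y0 := (within [:: false] ymap).
Notation y1 := (within [:: true] ymap).
Notation y0' := (within [:: false] yinv).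
Notation y1' := (within [:: true] yinv).

(** As x_1 x replaces the prefix 1 by 111, it conjugates y_1 to y_111, and [y_relation] can be
    rearranged. It follows that y_1 x y_1^{-1} lies in [G0]. *)
Lemma y1_x : y1 ** xmap =
  within [:: true; false] ymap ** within [:: true; true; false] yinv
    ** within [:: true] xmap ** xmap ** y1.
Proof.
have ix := inv_of_x; have i1 := inv_of_xs [:: true].
have E : within [:: true] xmap ** xmap ** (y1 ** (xinv ** within [:: true] xinv)) =
         within [:: true; true; true] ymap.
  apply: conj_within => [|xi]; first exact: inv_of_comp.
  by rewrite !lapp_cons lapp_nil /pcomp xE within_cons within_nil /= xE.
by rewrite {1}y_relation /= -E; group_eq.
Qed.

Lemma y0_x : xmap ** y0 = y0 ** (xmap ** within [:: false; true; false] yinv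
   ** within [:: false; true; true] ymap ** within [:: false] xmap).
Proof. by have ix := inv_of_x; rewrite {1}y0_expand; group_eq. Qed.

Lemma G0_ys_inv s : ~~ constant_word s -> G0 (within s yinv).
Proof. by move=> ns; apply: gen_inv (G0_ys ns) (inv_of_ys s). Qed.

Lemma G0_conj_closed g g' : inv_of g' g -> perm_group (fun f => G0 f /\ G0 (g ** (f ** g'))).
Proof.
move=> gg; split.
- split; first exact: gen_id.
  have -> : g ** (pid ** g') = pid by group_eq.
  exact: gen_id.
- move=> f1 f2 [G1 H1] [G2 H2]; split; first exact: gen_comp.
  have -> : g ** (f1 ** f2 ** g') = (g ** (f1 ** g')) ** (g ** (f2 ** g')) by group_eq.
  exact: gen_comp.
- move=> f1 f2 [G1 H1] f21; split; first exact: gen_inv f21.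
  by apply: gen_inv H1 _; split; group_eq.
- by move=> f [/(pgI G0_group)].
Qed.

(** The generators x_1 and y_10 are words in x and maps supported in the cone at 0. The latter
    commute with y_1, so only x needs [y1_x]. *)
Lemma y1_conj_G0 f : G0 f -> G0 (y1 ** (f ** y1')).
Proof.
have i1 := inv_of_ys [:: true]; have gP := G0_conj_closed i1.
suff H : forall f, G0 f -> G0 f /\ G0 (y1 ** (f ** y1')) by case/H.
have Px : G0 xmap /\ G0 (y1 ** (xmap ** y1')).
  split; first exact: G0_x.
  have -> : y1 ** (xmap ** y1') = (y1 ** xmap) ** y1' by [].
  have Gx1 := G0_xs [:: true]; have Gx := G0_x.
  rewrite y1_x.
  have -> : within [:: true; false] ymap ** within [:: true; true; false] yinv **
    within [:: true] xmap ** xmap ** y1 ** y1' = within [:: true; false] ymap **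
    within [:: true; true; false] yinv ** within [:: true] xmap ** xmap by group_eq.
  by group_mem G0_group; [apply: G0_ys | apply: G0_ys_inv].
have P0 s u : G0 (within (false :: s) u) ->
    G0 (within (false :: s) u) /\ G0 (y1 ** (within (false :: s) u ** y1')).
  move=> Gu; split=> //.
  have -> : y1 ** (within (false :: s) u ** y1') = (y1 ** within (false :: s) u) ** y1' by [].
  rewrite within_disjoint.
  by have -> : within (false :: s) u ** y1 ** y1' = within (false :: s) u by group_eq.
have ix := inv_of_x; have ix0 := inv_of_xs [:: false].
apply: (G0_gens0 gP) => g [] -> //.
- have -> : within [:: true] xmap = xmap ** xmap ** within [:: false] xinv ** xinv.
    by have := xx_relation [::]; rewrite within_nil /= => ->; group_eq.
  apply: (pgM gP); last exact: (pgV gP) ix.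
  apply: (pgM gP); first exact: (pgM gP).
  by apply: (pgV gP _ ix0); apply: P0; apply: G0_xs.
- have <- : xmap ** (within [:: false; true] ymap ** xinv) = within [:: true; false] ymap.
    by apply: conj_within => // xi; rewrite !lapp_cons xE.
  apply: (pgM gP) => //; apply: (pgM gP); last exact: (pgV gP) ix.
  by apply: P0; apply: G0_ys.
Qed.

(** The conjugation is opposite to the one by y_1, which explains the inverse in [W]. The generators
    x_1 and y_10 commute with y_0. *)
Lemma y0_conj_G0 f : G0 f -> G0 (y0' ** (f ** y0)).
Proof.
have i0 := inv_of_ys [:: false]; have gP := G0_conj_closed (inv_ofC i0).
suff H : forall f, G0 f -> G0 f /\ G0 (y0' ** (f ** y0)) by case/H.
have P1 s u : G0 (within (true :: s) u) ->
    G0 (within (true :: s) u) /\ G0 (y0' ** (within (true :: s) u ** y0)).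
  move=> Gu; split=> //; rewrite within_disjoint.
  by have -> : y0' ** (y0 ** within (true :: s) u) = within (true :: s) u by group_eq.
apply: (G0_gens0 gP) => g [] ->.
- split; first exact: G0_x.
  have Gx0 := G0_xs [:: false]; have Gx := G0_x.
  rewrite y0_x.
  have -> : y0' ** (y0 ** (xmap ** within [:: false; true; false] yinv **
     within [:: false; true; true] ymap ** within [:: false] xmap)) = xmap ** within [:: false;
         true; false] yinv **
     within [:: false; true; true] ymap ** within [:: false] xmap by group_eq.
  by group_mem G0_group; [apply: G0_ys_inv | apply: G0_ys].
- by apply: P1; apply: G0_xs.
- by apply: P1; apply: G0_ys.
Qed.

Notation W := (y1 ** y0').
Notation W' := (y0 ** y1').

Lemma inv_of_W : inv_of W' W.
Proof. by apply: inv_of_comp; [apply: inv_of_ys | apply/inv_ofC/inv_of_ys]. Qed.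

Lemma G_W : G W.
Proof. by apply: gen_comp; [apply: G_ys | apply: gen_inv (G_ys _) (inv_of_ys _)]. Qed.

Lemma W_conj_G0 f : G0 f -> G0 (W ** (f ** W')).
Proof.
move=> Gf; have -> : W ** (f ** W') = y1 ** ((y0' ** (f ** y0)) ** y1') by [].
by apply/y1_conj_G0/y0_conj_G0.
Qed.

(** The union of the increasing chain of groups [W^-n G0 W^n]. *)
Inductive tower : perm -> Prop :=
| tower_base f : G0 f -> tower f
| tower_step f : tower (W ** (f ** W')) -> tower f.

Lemma tower_W f : tower f -> tower (W ** (f ** W')).
Proof.
elim=> {}f => [/W_conj_G0|_ IH]; first exact: tower_base.
exact: tower_step.
Qed.

Lemma conj_comp g g' f h : inv_of g' g ->
  g ** (f ** h ** g') = (g ** (f ** g')) ** (g ** (h ** g')).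
Proof. by move=> gg; group_eq. Qed.

Lemma inv_of_conj g g' f f' : inv_of g' g -> inv_of f' f ->
  inv_of (g ** (f' ** g')) (g ** (f ** g')).
Proof. by move=> gg ff; split; group_eq. Qed.

Lemma conj_inv g g' f : inv_of g' g -> f = g' ** ((g ** (f ** g')) ** g).
Proof. by move=> gg; group_eq. Qed.

Lemma tower_group : perm_group tower.
Proof.
have iW := inv_of_W; split.
- exact/tower_base/gen_id.
- move=> f g Tf; elim: Tf g => {}f => [Gf g Tg|_ IH g /tower_W/IH].
    elim: Tg f Gf => {}g => [Gg f Gf|_ IH f /W_conj_G0/IH].
      exact/tower_base/gen_comp.
    by rewrite -conj_comp //; apply: tower_step.
  by rewrite -conj_comp //; apply: tower_step.
- move=> f g Tf; elim: Tf g => {}f => [Gf g gf|_ IH g gf].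
    by apply: tower_base; apply: gen_inv gf.
  by apply: tower_step; apply: IH; apply: inv_of_conj.
- move=> f; elim=> {}f => [/(pgI G0_group)//|_ [h hf]].
  exists (W' ** (h ** W)); rewrite (conj_inv f iW).
  exact: inv_of_conj (inv_ofC iW) hf.
Qed.

(** Enough conjugations by [W] bring both elements into [G0], where the commutator lies in K;
    normality of K in [G] brings it back. *)
Lemma tower_commutator f g f' g' : tower f -> tower g -> inv_of f' f -> inv_of g' g ->
  K (commutator f' g' f g).
Proof.
have iW := inv_of_W.
have down a b a' b' : K (commutator (W ** (a' ** W')) (W ** (b' ** W')) (W ** (a ** W')) (W **
    (b ** W'))) ->
    K (commutator a' b' a b).
  move=> /(K_normal_G (pgV G_group G_W iW) (inv_ofC iW)).
  by congr K; generalize W W' iW => w w' ?; group_eq.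
move=> Tf; elim: Tf g f' g' => {}f => [Gf g f' g' Tg|Tf IH g f' g' Tg ff gg]; last first.
  by apply: down; apply: IH; [apply: tower_W | apply: inv_of_conj | apply: inv_of_conj].
elim: Tg f f' g' Gf => {}g => [Gg f f' g' Gf|Tg IH f f' g' Gf ff gg].
  exact: derived_commutator.
by apply: down; apply: IH; [apply: W_conj_G0 | apply: inv_of_conj | apply: inv_of_conj].
Qed.

Lemma tower_conj g g' : (forall f, W ** ((g ** (f ** g')) ** W') = g ** ((W ** (f ** W')) ** g')) ->
    (forall f, G0 f -> tower (g ** (f ** g'))) ->
  forall f, tower f -> tower (g ** (f ** g')).
Proof.
move=> E G0T f; elim=> {}f => [/G0T//|_ IH].
by apply: tower_step; rewrite E.
Qed.

Lemma tower_normal : normalizes G tower.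
Proof.
have gT := tower_group; have i0 := inv_of_ys [:: false]; have i1 := inv_of_ys [:: true].
(* Both directions are recorded to make [P] closed under inversion. *)
pose P g := G g /\ forall g', inv_of g' g -> forall f, tower f ->
  tower (g ** (f ** g')) /\ tower (g' ** (f ** g)).
suff GP : forall g, G g -> P g by move=> g g' f /GP[_ H] gg Tf; apply: (H _ gg _ Tf).1.
have gP : perm_group P.
  split.
  - split=> [|g' gg f Tf]; first exact: gen_id.
    by have -> : g' = pid by apply: inv_of_uniq gg inv_of_id.
  - move=> g h [Gg Pg] [Gh Ph]; split=> [|k' kk f Tf]; first exact: gen_comp.
    have [g' gg] := pgI G_group Gg; have [h' hh] := pgI G_group Gh.
    have -> : k' = h' ** g' by apply: inv_of_uniq kk (inv_of_comp gg hh).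
    split.
      by have [/(Pg _ gg)[]] := Ph _ hh _ Tf.
    by have [_ /(Ph _ hh)[]] := Pg _ gg _ Tf.
  - move=> g h [Gg Pg] hg; split=> [|g2 gg f Tf]; first exact: gen_inv hg.
    have -> : g2 = g by apply: inv_of_uniq gg (inv_ofC hg).
    by have [] := Pg _ hg _ Tf.
  - by move=> g [/(pgI G_group)].
have c01 : y1 ** y0 = y0 ** y1 by apply: within_disjoint.
have c01' : y1 ** y0' = y0' ** y1 by apply: within_disjoint.
have c1'0 : y1' ** y0 = y0 ** y1' by apply: within_disjoint.
have c1'0' : y1' ** y0' = y0' ** y1' by apply: within_disjoint.
have T1 f : tower f -> tower (y1 ** (f ** y1')).
  apply: tower_conj => {}f; last by move/y1_conj_G0/tower_base.
  transitivity (y1 ** (y0' ** y1) ** f ** (y1' ** y0) ** y1'); first by [].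
  by rewrite c1'0 -c01'.
have T0' f : tower f -> tower (y0' ** (f ** y0)).
  apply: tower_conj => {}f; last by move/y0_conj_G0/tower_base.
  transitivity ((y1 ** y0') ** y0' ** f ** y0 ** (y0 ** y1')); first by [].
  transitivity ((y0' ** y1) ** y0' ** f ** y0 ** (y1' ** y0)); last by [].
  by rewrite -c01' c1'0.
(* Conjugation by [W] cancels y_1 and leaves conjugation by y_0^{-1}, so one [tower_step]
   suffices. *)
have T1' f : tower f -> tower (y1' ** (f ** y1)).
  move=> Tf; apply: tower_step.
  have -> : W ** (y1' ** (f ** y1) ** W') = y0' ** (f ** y0).
    transitivity (y1 ** (y0' ** y1') ** f ** (y1 ** y0) ** y1'); first by [].
    by rewrite -c1'0' c01; group_eq.
  exact: T0'.
have T0 f : tower f -> tower (y0 ** (f ** y0')).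
  move=> Tf; apply: tower_step.
  have -> : W ** (y0 ** (f ** y0') ** W') = y1 ** (f ** y1') by group_eq.
  exact: T1.
apply: (G_gens gP) => g Sg; split=> [|g' gg f Tf]; first exact: gens_G.
case: Sg gg => [/gens0_G0 Gg gg|-> gg|-> gg].
- have Tg := tower_base Gg; have Tg' := pgV gT Tg gg.
  by split; group_mem gT.
- by rewrite (inv_of_uniq gg i0); split; [apply: T0 | apply: T0'].
- by rewrite (inv_of_uniq gg i1); split; [apply: T1 | apply: T1'].
Qed.

(** Modulo the tower only y_0 and y_1 remain as generators, and their supports are disjoint. *)
Lemma G'_tower f : derived G f -> tower f.
Proof.
apply: derived_min; first exact: tower_group.
apply: (com_generators G_group tower_group tower_normal gens_G G_gens) => a b Sa Sb.
have gT := tower_group.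
case: (Sa) => [/gens0_G0/tower_base Ta|Ea|Ea].
  exact: com_normalized G_group gT tower_normal Ta (gens_G Sb).
all: case: (Sb) => [/gens0_G0/tower_base Tb|->|->]; rewrite ?Ea; try exact: com_refl;
  try (by apply: com_sym => //; apply: com_normalized G_group gT tower_normal Tb _; apply: G_ys).
- by exists pid; [apply: pg1 | rewrite -within_disjoint].
- by exists pid; [apply: pg1 | rewrite within_disjoint].
Qed.

Lemma G''_eq_K : derived (derived G) = K.
Proof.
apply: functional_extensionality => f; apply: propositional_extensionality; split.
  apply: derived_min f => [|a b a' b' /G'_tower Ta /G'_tower Tb]; first exact: K_group.
  exact: tower_commutator.
move/K_perfect; apply: derived_mono; last exact: derived_group G_group.
by apply: derived_mono; [apply: G0_G | apply: G_group].
Qed.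

Lemma G''_neq_G' : ~ same_set (derived (derived G)) (derived G).
Proof.
rewrite G''_eq_K => E.
have i1 := inv_of_ys [:: true]; have ix := inv_of_x; have Gx := G0_G G0_x.
have C : K (commutator y1 xmap y1' xinv).
  apply/E; apply: derived_commutator; [apply: gen_inv (G_ys _) i1 | apply: gen_inv Gx ix | |];
    exact: inv_ofC.
have [n fn] := K_fixes_ends C.
(* The commutator is y_10 y_110^{-1} x_1, which sends 1^{n+2} 0^oo, a point of the n-th ends, to
   1^{n+3} 0^oo. *)
have := fn (lapp (nseq n.+2 true) (cconst false)); rewrite /commutator.
have -> : y1 ** (xmap ** (y1' ** xinv)) = (y1 ** xmap) ** (y1' ** xinv) by [].
rewrite y1_x.
have -> : within [:: true; false] ymap ** within [:: true; true; false] yinv **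
   within [:: true] xmap ** xmap ** y1 ** (y1' ** xinv) =
   within [:: true; false] ymap ** within [:: true; true; false] yinv **
       within [:: true] xmap by group_eq.
rewrite /pcomp !lapp_nseqSr; do 4!rewrite ?within_cons ?within_nil ?xE /=.
have E' : ends n (true |> true |> lapp (nseq n true) (cconst false)).
  by exists true, (lapp [:: true; true] (cconst false));
      rewrite -!lapp_nseqSr -addn2 nseqD lapp_cat.
move=> /(_ E')/ccons_inj[_ /ccons_inj[_]].
by rewrite -lapp_nseqSr lapp_nseqS => /lapp_inj /(congr1 (@^~ 0)); rewrite cconsE.
Qed.

Theorem theorem2 :
  (* G0 *)
  (simple (derived G0) /\
   (forall N, normal_in N G0 -> ~ trivial N -> quot_abelian G0 N) /\
   (forall H, is_subgroup H G0 -> finite_index H G0 -> normal_in H G0)) /\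
  (* G *)
  (~ same_set (derived (derived G)) (derived G) /\
   (simple (derived (derived G)) /\ same_set (derived (derived G)) (derived G0)) /\
   (forall N, normal_in N G -> ~ trivial N -> quot_metabelian G N)).
Proof.
split; [split; [exact: K_simple | split] | split; [exact: G''_neq_G' | split]].
- move=> N [sN nN]; apply: nontrivial_quotient_abelian nN.
    exact: subgroup_group G0_group sN.
  by case: sN => NG0 _ _ _ f /NG0/G0_G.
- exact: finite_index_normal.
- by rewrite G''_eq_K; split; [exact: K_simple |].
- move=> N [sN nN] ntriv a b a' b' Ga Gb aa bb.
  have gN := subgroup_group G_group sN; have NG : forall f, N f -> G f by case: sN.
  (* As K = G0', it suffices that N contains the commutators of [G0], and N is normalized by
     [G0]. *)
  have : K (commutator a' b' a b) by rewrite -G''_eq_K; apply: derived_commutator.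
  apply: derived_min => //; apply: nontrivial_quotient_abelian => //.
  by move=> g g' f /G0_G; apply: nN.
Qed.
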